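(* Let $\Theta$ and $B$ be finite Blaschke products with $\deg B<\deg\Theta$ and $B$ unicritical. Then $$\max\{|B(z)| : z\in W(S_\Theta)\}\ge \tfrac12.$$
   Context: $\mathbb{D}$ is the open unit disk and $\mathbb{T}$ the unit circle. A finite Blaschke product of degree $n$ is a function $\lambda \prod_{j=1}^n \frac{z-a_j}{1-\bar{a}_j z}$ with $a_1,\dots,a_n\in\mathbb{D}$ (not necessarily distinct) and $\lambda\in\mathbb{T}$. It is called unicritical if it has the form $\lambda\left(\frac{z-z_0}{1-\bar z_0 z}\right)^m$ with $z_0\in\mathbb{D}$, $m\ge1$, $\lambda\in\mathbb{T}$. For a finite Blaschke product $\Theta$, $K_\Theta = H^2\ominus \Theta H^2$, where $H^2=H^2(\mathbb{D})$ is the Hardy space; $\dim K_\Theta = \deg\Theta$. The compression of the shift is $S_\Theta = P_\Theta M_z|_{K_\Theta}$, where $P_\Theta$ is the orthogonal projection of $H^2$ onto $K_\Theta$ and $M_z$ is multiplication by $z$. The numerical range of an operator $A$ is $W(A)=\{\langle Ax,x\rangle : \|x\|=1\}$. *)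

(* Defs.v *)
From HB Require Import structures.
From mathcomp Require Import all_boot all_order all_algebra complex.
From mathcomp Require Import all_classical all_reals all_analysis.
Set Implicit Arguments. Unset Strict Implicit. Unset Printing Implicit Defensive.
Import Order.TTheory GRing.Theory Num.Theory numFieldNormedType.Exports.
Local Open Scope classical_set_scope.
Local Open Scope ring_scope.
Local Open Scope complex_scope.

Definition unit_disk (R : realType) : set R[i] := [set z | `|z| < 1].

Record finite_blaschke (R : realType) := FiniteBlaschke {
  blaschke_const : R[i];
  blaschke_zeros : seq R[i];
  blaschke_constP : `|blaschke_const| = 1;
  blaschke_zerosP : forall a, a \in blaschke_zeros -> unit_disk a }.

Definition blaschke_deg (R : realType) (B : finite_blaschke R) : nat :=
  size (blaschke_zeros B).

Definition blaschke_eval (R : realType) (B : finite_blaschke R) (z : R[i]) :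
    R[i] :=
  blaschke_const B * \prod_(a <- blaschke_zeros B) ((z - a) / (1 - a^* * z)).

Coercion blaschke_eval : finite_blaschke >-> Funclass.

Definition unicritical (R : realType) (B : finite_blaschke R) : Prop :=
  exists (z0 lambda : R[i]) (m : nat),
    [/\ unit_disk z0, `|lambda| = 1, (1 <= m)%N &
      forall z, unit_disk z ->
        B z = lambda * ((z - z0) / (1 - z0^* * z)) ^+ m].

(* An element of the Hardy space is represented by the sequence of its Taylor
   coefficients at 0, which has to be square-summable; [H2_eval f] is the
   holomorphic function on the unit disk.
   The type [R[i]^o] is [R[i]] with the topology of its norm. *)
Definition H2 (R : realType) : set (nat -> R[i]) :=
  [set f | cvgn (series (fun n => `|f n| ^+ 2 : R[i]^o))].

Definition H2_eval (R : realType) (f : nat -> R[i]) (z : R[i]) : R[i] :=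
  limn (series (fun n => f n * z ^+ n : R[i]^o)).

Definition H2_inner (R : realType) (f g : nat -> R[i]) : R[i] :=
  limn (series (fun n => f n * (g n)^* : R[i]^o)).

Definition H2_norm (R : realType) (f : nat -> R[i]) : R[i] :=
  sqrtC (H2_inner f f).

(* Taylor coefficients of z |-> z * f z *)
Definition mulz (R : realType) (f : nat -> R[i]) : nat -> R[i] :=
  fun n => if n is k.+1 then f k else 0.

Definition theta_H2 (R : realType) (Theta : R[i] -> R[i]) :
    set (nat -> R[i]) :=
  [set g | H2 g /\ exists2 h, H2 h &
    forall z, unit_disk z -> H2_eval g z = Theta z * H2_eval h z].

Definition model_space (R : realType) (Theta : R[i] -> R[i]) :
    set (nat -> R[i]) :=
  [set f | H2 f /\ forall g, theta_H2 Theta g -> H2_inner f g = 0].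

(* The value 0 is used only if [f] has no orthogonal projection onto [K]; this
   does not occur for [f] in [H2] and [K] a closed subspace of [H2]. *)
Definition orth_proj (R : realType) (K : set (nat -> R[i]))
    (f : nat -> R[i]) : nat -> R[i] :=
  xget (fun=> 0) [set p | K p /\
    forall k, K k -> H2_inner (fun n => f n - p n) k = 0].

Definition compressed_shift (R : realType) (Theta : R[i] -> R[i])
    (f : nat -> R[i]) : nat -> R[i] :=
  orth_proj (model_space Theta) (mulz f).

Definition numerical_range (R : realType) (K : set (nat -> R[i]))
    (A : (nat -> R[i]) -> (nat -> R[i])) : set R[i] :=
  [set H2_inner (A f) f | f in [set f | K f /\ H2_norm f = 1]].

Definition is_max (R : realType) (A : set R[i]) (m : R[i]) : Prop :=
  A m /\ ubound A m.

(* Main.v *)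
(* Write Theta = lambda prod (z - a_j) / (1 - a_j^* z) with n = deg Theta. The space K_Theta
   consists of the functions p / prod (1 - a_j^* z) with deg p < n, and S_Theta is
   multiplication by z modulo prod (X - a_j). If B = lambda b^m with b a Moebius map
   and m < n, then b(S_Theta)^m maps some nonzero x isometrically to b^m x.
   Assume |b| < rho on W(S_Theta) with rho^m < 1/2. The set |b| < rho is a Euclidean
   disk, so A := (S_Theta - center) / radius has numerical radius < 1, and
   T := b(S_Theta) / rho is a Moebius transform (A + f) (1 + f^* A)^-1 of A, with
   |T^m x| = rho^-m |x| > 2 |x|. This contradicts |T^m x| <= 2 |x|, which is shown as
   follows. The condition w(A) < 1 means Re (1 - t A)^-1 > 0 for all unimodular t.
   It is transported to T (with a Poisson kernel as error term) by a Moebius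
   substitution, then to T^m by averaging over the m-th roots of t (as in the proof of
   the power inequality), then back to a Moebius transform G of T^m with w(G) < 1.
   Finally T^m x is compared with x by testing w(G) < 1 on four vectors. *)

Require Import Defs.
From HB Require Import structures.
From mathcomp Require Import all_boot all_order all_algebra all_solvable all_field complex.
From mathcomp Require Import all_classical all_reals all_analysis.
From mathcomp Require Import ring lra zify.
Set Implicit Arguments. Unset Strict Implicit. Unset Printing Implicit Defensive.
Import Order.TTheory GRing.Theory Num.Theory numFieldNormedType.Exports.
Local Open Scope classical_set_scope.
Local Open Scope ring_scope.

(** * Unimodular numbers, averages over roots of unity, the Poisson kernel *)

Section ClosedFieldFacts.
Context {C : numClosedFieldType}.
Implicit Types z w t : C.

(** The power inequality is about w(T) < 1, but a Moebius map that does not fix 0 destroys this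
    condition: T takes the value [f] at A = 0. What survives is Re (1 + t T) / (1 - t T) > -
    [poisson f t]. This family of inequalities is closed under powers, because the mean of
    [poisson f] over the m-th roots of t is [poisson (f ^+ m) t]. All inequalities are strict and
    hold for an arbitrary positive definite Hermitian form on row vectors. Strictness makes the
    denominators of the Moebius maps invertible; the freedom in the form avoids an orthonormal basis
    of K_Theta, since the inner product of H^2 is pulled back to the numerators p. The vector x has
    the numerator (1 - z0^* X)^(deg Theta - 1). On the circle |z - z0| = |1 - z0^* z|, so each
    application of b(S_Theta) trades one factor for X - z0 and keeps the norm; m < deg Theta
    provides enough factors. *)

Lemma unimodular_neq0 z : `|z| = 1 -> z != 0.
Proof. by move=> z1; rewrite -normr_gt0 z1. Qed.

Lemma unimodular_conj z : `|z| = 1 -> z^* = z^-1.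
Proof.
by move=> z1; apply: (mulfI (unimodular_neq0 z1)); rewrite -normCK z1 expr1n divff ?unimodular_neq0.
Qed.

Lemma sub1M_neq0 z w : `|z| <= 1 -> `|w| < 1 -> 1 - z * w != 0.
Proof.
move=> z1 w1; rewrite subr_eq0; apply/eqP => E.
have : `|z * w| < 1.
  by rewrite normrM; apply: le_lt_trans w1; rewrite ler_piMl ?normr_ge0.
by rewrite -E normr1 ltxx.
Qed.

Lemma sub1_mulCK_gt0 z : `|z| < 1 -> 0 < 1 - z * z^*.
Proof. by move=> z1; rewrite -normCK subr_gt0 exprn_ilt1 ?normr_ge0. Qed.

Lemma prim_root_exists m : (0 < m)%N -> exists z : C, m.-primitive_root z.
Proof.
pose p : {poly C} := 'X^m - 1; have [r Dp] := closed_field_poly_normal p.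
move=> m_gt0; rewrite (monicP _) ?monicXnsubC // scale1r in Dp.
have rn1: all m.-unity_root r by apply/allP=> z; rewrite -root_prod_XsubC -Dp.
have sz_r: (m < (size r).+1)%N.
  by rewrite -(size_prod_XsubC r id) -Dp size_XnsubC.
have [|z] := hasP (has_prim_root m_gt0 rn1 _ sz_r); last by exists z.
by rewrite -separable_prod_XsubC -Dp separable_Xn_sub_1 // pnatr_eq0 -lt0n.
Qed.

Lemma roots_average m t : (0 < m)%N -> `|t| = 1 ->
  exists eta : 'I_m -> C, [/\ forall k, `|eta k| = 1,
    forall k, eta k ^+ m = t &
    forall j, (0 < j < m)%N -> \sum_k eta k ^+ j = 0].
Proof.
move=> m0 t1; have [w wP] := prim_root_exists m0.
have w1 : `|w| = 1.
  apply/eqP; rewrite -(@pexpr_eq1 _ _ m) ?normr_ge0 //.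
  by rewrite -normrX (prim_expr_order wP) normr1.
exists (fun k : 'I_m => m.-root t * w ^+ k); split.
- by move=> k; rewrite normrM normrX w1 expr1n mulr1 norm_rootC t1 rootC1.
- by move=> k; rewrite exprMn rootCK // -exprM mulnC exprM (prim_expr_order wP) expr1n mulr1.
move=> j /andP[j0 jm]; under eq_bigr do rewrite exprMn -exprM mulnC exprM.
rewrite -mulr_sumr; suff -> : \sum_(i < m) (w ^+ j) ^+ i = 0 by rewrite mulr0.
have := subrX1 (w ^+ j) m; rewrite -exprM mulnC exprM (prim_expr_order wP) expr1n subrr.
move=> /esym/eqP; rewrite mulf_eq0 => /orP[|/eqP//].
by rewrite subr_eq0 -(prim_order_dvd wP) gtnNdvd.
Qed.

(* [poisson f t] is the Poisson kernel of [f] at [t^*]. *)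
Definition poisson (f t : C) := (1 - t * f)^-1 + ((1 - t * f)^-1)^* - 1.

Lemma geometric_sum (T : nzRingType) (x : T) m :
  (\sum_(j < m) x ^+ j) * (1 - x) = 1 - x ^+ m.
Proof.
elim: m => [|m IH]; first by rewrite big_ord0 mul0r subrr.
by rewrite big_ord_recr mulrDl IH /= mulrBr mulr1 -exprSr addrA subrK.
Qed.

Lemma roots_average_sum (W : lmodType C) m (eta : 'I_m -> C) (x : nat -> W) :
  (0 < m)%N -> (forall j, (0 < j < m)%N -> \sum_k eta k ^+ j = 0) ->
  \sum_k \sum_(j < m) eta k ^+ j *: x j = m%:R *: x 0%N.
Proof.
case: m eta => // m eta _ eta0; rewrite exchange_big big_ord_recl /=.
rewrite [X in _ + X]big1 => [|j _]; last first.
  by rewrite -scaler_suml eta0 ?scale0r //= ltnS ltn_ord.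
rewrite addr0 -scaler_suml; congr (_ *: _).
by rewrite (eq_bigr (fun=> 1)) // sumr_const card_ord.
Qed.

(** Since 1 / (1 - eta f) is 1 / (1 - t f^m) times the sum of (eta f)^j over j < m, the mean over
    the roots eta keeps only the term j = 0. *)
Lemma poisson_sum m (eta : 'I_m -> C) (f t : C) : (0 < m)%N -> `|f| < 1 ->
  (forall i, `|eta i| = 1) -> (forall i, eta i ^+ m = t) ->
  (forall j, (0 < j < m)%N -> \sum_k eta k ^+ j = 0) ->
  \sum_k poisson f (eta k) = m%:R * poisson (f ^+ m) t.
Proof.
move=> m0 f1 eta1 etam eta0.
have S : \sum_k (1 - eta k * f)^-1 = m%:R * (1 - t * f ^+ m)^-1.
  have E k : (1 - eta k * f)^-1 =
      (1 - t * f ^+ m)^-1 * \sum_(j < m) eta k ^+ j *: (f ^+ j : C^o).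
    have d0 : 1 - eta k * f != 0 by rewrite sub1M_neq0 ?eta1.
    have -> : \sum_(j < m) eta k ^+ j *: (f ^+ j : C^o) = \sum_(j < m) (eta k * f) ^+ j.
      by apply: eq_bigr => j _; rewrite exprMn.
    rewrite -(etam k) -exprMn -geometric_sum; set s := \sum_(_ < _) _.
    have s0 : s != 0.
      apply/eqP => s0; have := geometric_sum (eta k * f) m; rewrite -/s s0 mul0r.
      move=> /esym/eqP; rewrite exprMn etam; apply/negP.
      apply: sub1M_neq0; first by rewrite -(etam k) normrX eta1 expr1n.
      by rewrite normrX exprn_ilt1 ?normr_ge0 // -lt0n.
    by field; rewrite s0 d0.
  under eq_bigr do rewrite E; rewrite -mulr_sumr (roots_average_sum (fun j => f ^+ j : C^o) m0 eta0).
  by rewrite expr0 -[_ *: _]/(_ * _) mulr1 mulrC.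
rewrite /poisson sumrB big_split /= S -rmorph_sum S rmorphM rmorph_nat /=.
by rewrite sumr_const card_ord; ring.
Qed.

End ClosedFieldFacts.

(** * Berger-type positivity under Moebius maps and powers *)

Section HermitianForm.
Context {C : numClosedFieldType} {n : nat} (dot : 'rV[C]_n.+1 -> 'rV[C]_n.+1 -> C).
Hypothesis dotDl : forall u v w, dot (u + v) w = dot u w + dot v w.
Hypothesis dotZl : forall a u w, dot (a *: u) w = a * dot u w.
Hypothesis dotC : forall u v, dot v u = (dot u v)^*.
Hypothesis dot_gt0 : forall v, v != 0 -> 0 < dot v v.
Local Notation V := 'rV[C]_n.+1.
Local Notation M := 'M[C]_n.+1.
Implicit Types (u v w y z h k : V) (f t : C).

Lemma dotDr u v w : dot w (u + v) = dot w u + dot w v.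
Proof. by rewrite dotC dotDl rmorphD (dotC u) (dotC v). Qed.
Lemma dotZr a u w : dot w (a *: u) = a^* * dot w u.
Proof. by rewrite dotC dotZl rmorphM (dotC u). Qed.
Lemma dotNl u w : dot (- u) w = - dot u w.
Proof. by rewrite -scaleN1r dotZl mulN1r. Qed.
Lemma dotNr u w : dot w (- u) = - dot w u.
Proof. by rewrite dotC dotNl rmorphN (dotC u). Qed.
Lemma dot0l w : dot 0 w = 0.
Proof. by rewrite -(scale0r 0) dotZl mul0r. Qed.
Lemma dot0r w : dot w 0 = 0.
Proof. by rewrite dotC dot0l rmorph0. Qed.
Lemma dot_ge0 v : 0 <= dot v v.
Proof. by have [->|/dot_gt0/ltW//] := eqVneq v 0; rewrite dot0l. Qed.
Lemma dot_suml I (r : seq I) (F : I -> V) w :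
  dot (\sum_(i <- r) F i) w = \sum_(i <- r) dot (F i) w.
Proof.
by apply: (big_morph (dot^~ w)) => [u v|]; rewrite ?dotDl ?dot0l.
Qed.
Definition dotE := (dotDl, dotDr, dotNl, dotNr, dotZl, dotZr).

(* Positivity of [berger f t h (h *m F)] for all [h] and all unimodular [t] is
   Re (1 + t F) / (1 - t F) >= - poisson f t. *)
Definition berger f t h k :=
  dot h h - dot k k + poisson f t * dot (h - t *: k) (h - t *: k).

Definition berger_pos (F : M) f :=
  forall h t, h != 0 -> `|t| = 1 -> 0 < berger f t h (h *m F).

(** At [f = 0] the Poisson kernel is 1, and for z = y A positivity over all unimodular [t] says that
    A has numerical radius less than 1. *)
Lemma berger0 t y z : `|t| = 1 ->
  berger 0 t y z = 2 * dot y y - t * dot z y - (t * dot z y)^*.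
Proof.
move=> t1; rewrite /berger /poisson mulr0 subr0 invr1 rmorph1 addrK mul1r.
rewrite !dotE rmorphM /= (dotC z y) (unimodular_conj t1).
by field; apply: unimodular_neq0.
Qed.

(** Write h, k for the two arguments on the left and t' for the parameter on the right. Then h - t k
    = (1 - t f) (y - t' z) and |h|^2 - |k|^2 = (1 - |f|^2) (|y|^2 - |z|^2), while [poisson f t] is
    (1 - |f|^2) / |1 - t f|^2. *)
Lemma berger_moebius f t y z : `|f| < 1 -> `|t| = 1 ->
  berger f t (y + f^* *: z) (z + f *: y) =
  (1 - f * f^*) * berger 0 ((t - f^*) / (1 - t * f)) y z.
Proof.
move=> f1 t1.
have d0 : 1 - t * f != 0 by rewrite sub1M_neq0 ?t1.
have d1 : t - f^* != 0.
  rewrite subr_eq0; apply/eqP => E; move: t1; rewrite E norm_conjC => E'.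
  by rewrite E' ltxx in f1.
have tn0 := unimodular_neq0 t1.
rewrite /berger /poisson mulr0 subr0 invr1 rmorph1 addrK mul1r.
rewrite !dotE !(rmorphM, rmorphB, fmorphV, rmorph1, conjCK) /=.
rewrite (unimodular_conj t1) (dotC z y) ?conjCK.
move: d0 d1; move: (f^*) => g d0 d1.
by field; rewrite tn0 d0 d1.
Qed.

(** For a fixed [u] the right side is additive in [h] and the Poisson term taken together, so it can
    be averaged in [berger_pos_exp]. *)
Lemma bergerE f t h k : `|t| = 1 -> let u := h - t *: k in
  berger f t h k = dot h u + dot u h + (poisson f t - 1) * dot u u.
Proof.
move=> t1 /=; rewrite /berger; set P := poisson f t.
rewrite !dotE (unimodular_conj t1).
by field; apply: unimodular_neq0.
Qed.

Lemma numrad_berger_pos (A : M) :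
  (forall v, v != 0 -> `|dot (v *m A) v| < dot v v) -> berger_pos A 0.
Proof.
move=> wA h t h0 t1; rewrite berger0 //; set c := t * _.
have hn : `|c| < dot h h by rewrite normrM t1 mul1r wA.
have -> : 2 * dot h h - c - c^* = 2 * (dot h h - 'Re c).
  by rewrite ReE; field.
rewrite mulr_gt0 // subr_gt0; apply: le_lt_trans hn.
exact: (leif_Re_Creal c).1.
Qed.

Lemma unitmx_inj (F : M) : (forall h, h != 0 -> h *m F != 0) -> F \is a GRing.unit.
Proof.
move=> inj; rewrite -[_ \is a _]/(_ \in unitmx) -row_free_unit -kermx_eq0.
apply/eqP/row_matrixP => i; rewrite row0; apply/eqP; apply/negPn/negP => /inj.
by rewrite -row_mul mulmx_ker row0 eqxx.
Qed.

Lemma numrad_unit (A : M) f : (forall v, v != 0 -> `|dot (v *m A) v| < dot v v) ->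
  `|f| < 1 -> 1 + f *: A \is a GRing.unit.
Proof.
move=> wA f1; apply: unitmx_inj => h h0; apply/eqP => E.
have := congr1 (dot^~ h) E; rewrite mulmxDr mulmx1 -scalemxAr dotDl dotZl dot0l.
move=> /eqP; rewrite addr_eq0 => /eqP /(congr1 Num.norm).
rewrite normrN normrM (ger0_norm (dot_ge0 h)) => E2.
have /lt_geF := wA _ h0; rewrite E2.
by rewrite ler_piMl ?normr_ge0 // ltW.
Qed.

Lemma moebius_unimodular f t : `|f| < 1 -> `|t| = 1 ->
  `|(t - f^*) / (1 - t * f)| = 1.
Proof.
move=> f1 t1; have d0 : 1 - t * f != 0 by rewrite sub1M_neq0 ?t1.
have -> : t - f^* = t * (1 - t * f)^*.
  rewrite rmorphB rmorphM rmorph1 /= (unimodular_conj t1).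
  by field; apply: unimodular_neq0.
by rewrite !normrM normfV norm_conjC t1 mul1r divff ?normr_eq0.
Qed.

Lemma berger_pos_moebius (A : M) f : `|f| < 1 -> 1 + f^* *: A \is a GRing.unit ->
  berger_pos A 0 -> berger_pos ((1 + f^* *: A)^-1 * (A + f%:M)) f.
Proof.
move=> f1 uA bA h t h0 t1; set U := 1 + _ in uA *.
pose y := h *m U^-1; pose z := y *m A.
have hE : h = y + f^* *: z.
  have -> : y + f^* *: z = y *m U by rewrite mulmxDr mulmx1 -scalemxAr.
  by rewrite -mulmxA -[U^-1 *m U]/(U^-1 * U) mulVr // mulmx1.
have y0 : y != 0.
  by apply: contraNneq h0 => y0; rewrite hE /z y0 mul0mx scaler0 addr0.
have -> : h *m (U^-1 * (A + f%:M)) = z + f *: y.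
  by rewrite -[U^-1 * _]/(U^-1 *m _) mulmxA mulmxDr mul_mx_scalar.
by rewrite hE berger_moebius // mulr_gt0 ?sub1_mulCK_gt0 ?bA ?moebius_unimodular.
Qed.

Lemma berger_scale f t (c : C) h k :
  berger f t (c *: h) (c *: k) = c * c^* * berger f t h k.
Proof.
by rewrite /berger !scalerA [t * c]mulrC -scalerA -scalerBr !(dotZl, dotZr); ring.
Qed.

(** A kernel vector satisfies h = f^* (h F). This is the case y = 0 of [berger_moebius], where the
    right side is 0. *)
Lemma berger_pos_unit (F : M) f : `|f| < 1 -> berger_pos F f ->
  1 - f^* *: F \is a GRing.unit.
Proof.
move=> f1 bF; apply: unitmx_inj => h h0; apply/eqP => E.
have hE : h = 0 + f^* *: (h *m F).
  apply/eqP; rewrite add0r -subr_eq0; apply/eqP; rewrite -[RHS]E.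
  by rewrite mulmxBr mulmx1 -scalemxAr.
have := berger_moebius 0 (h *m F) f1 (normr1 _).
rewrite -hE scaler0 addr0 berger0 ?moebius_unimodular ?normr1 //.
rewrite !dot0r !mulr0 rmorph0 !subr0 mulr0 => E0.
by have := bF h 1 h0 (normr1 _); rewrite E0 ltxx.
Qed.

(** Up to the factor 1 - |f|^2, the substitution of [berger_moebius] is inverted by y = h - f^* k, z
    = k - f h. *)
Lemma berger_pos_moebiusV (F : M) f : `|f| < 1 -> berger_pos F f ->
  berger_pos ((1 - f^* *: F)^-1 * (F - f%:M)) 0.
Proof.
move=> f1 bF y t' y0 t'1; have uF := berger_pos_unit f1 bF; set U := 1 - _ in uF *.
pose h := y *m U^-1; pose k := h *m F; pose z := k - f *: h.
have -> : y *m (U^-1 * (F - f%:M)) = z.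
  by rewrite -[U^-1 * _]/(U^-1 *m _) mulmxA mulmxBr mul_mx_scalar.
have yE : y = h - f^* *: k.
  have -> : h - f^* *: k = h *m U by rewrite mulmxBr mulmx1 -scalemxAr.
  by rewrite -mulmxA -[U^-1 *m U]/(U^-1 * U) mulVr // mulmx1.
have h0 : h != 0.
  by apply: contraNneq y0 => h0; rewrite yE /k h0 mul0mx scaler0 subr0.
have f0 := sub1_mulCK_gt0 f1.
have d0 : 1 + t' * f != 0.
  by rewrite -[t']opprK mulNr sub1M_neq0 ?normrN ?t'1.
(* The preimage of [t'] under the circle map of [berger_moebius]: the same map with [- f] for
   [f]. *)
pose t := (t' + f^*) / (1 + t' * f).
have t1 : `|t| = 1.
  have := @moebius_unimodular (- f) t'.
  by rewrite normrN rmorphN /= opprK mulrN opprK; apply.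
have tE : (t - f^*) / (1 - t * f) = t'.
  rewrite /t; field.
  have -> : 1 + t' * f - (t' + Num.conj f) * f = 1 - f * f^* by ring.
  by rewrite d0 lt0r_neq0.
have := berger_moebius y z f1 t1; rewrite tE.
have -> : y + f^* *: z = (1 - f * f^*) *: h.
  by rewrite yE /z scalerBr scalerA scalerBl scale1r addrA subrK mulrC.
have -> : z + f *: y = (1 - f * f^*) *: k.
  by rewrite yE /z scalerBr scalerA scalerBl scale1r addrA subrK.
rewrite berger_scale => E; rewrite -(pmulr_rgt0 _ f0) -E mulr_gt0 ?bF //.
by rewrite -normCK exprn_gt0 // normr_gt0 lt0r_neq0.
Qed.

(** The vectors [hk i] are chosen so that hk_i (1 - eta_i F) = h (1 - t F^m) does not depend on i,
    while their mean is h. Averaging [bergerE] over i therefore gives the form for F^m. *)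
Lemma berger_pos_exp (F : M) f m : (0 < m)%N -> `|f| < 1 ->
  berger_pos F f -> berger_pos (F ^+ m) (f ^+ m).
Proof.
move=> m0 f1 bF h t h0 t1.
have [eta [eta1 etam eta0]] := roots_average m0 t1.
pose hk i := h *m (\sum_(j < m) (eta i *: F) ^+ j).
pose u := h - t *: (h *m F ^+ m).
have hkE (i : 'I_m) : hk i - eta i *: (hk i *m F) = u.
  rewrite scalemxAr -{1}[hk i]mulmx1 -mulmxBr -mulmxA.
  by rewrite -[_ *m (1%:M - _)]/(_ * (1 - _)) geometric_sum exprZn etam mulmxBr mulmx1 -scalemxAr.
have hkS : \sum_i hk i = m%:R *: h.
  rewrite -[h in RHS]mulmx1 -[1%:M]/(F ^+ 0) -(roots_average_sum (fun j => h *m F ^+ j) m0 eta0).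
  apply: eq_bigr => i _; rewrite /hk mulmx_sumr; apply: eq_bigr => j _.
  by rewrite exprZn scalemxAr.
have bE (i : 'I_m) : berger f (eta i) (hk i) (hk i *m F) =
    dot (hk i) u + dot u (hk i) + (poisson f (eta i) - 1) * dot u u.
  by rewrite bergerE // hkE.
have b_ge0 (i : 'I_m) : 0 <= berger f (eta i) (hk i) (hk i *m F).
  have [E|/bF/(_ (eta1 i))/ltW//] := eqVneq (hk i) 0.
  by rewrite /berger E mul0mx scaler0 subr0 !dot0l mulr0 addr0 subr0.
have mh : m%:R * berger (f ^+ m) t h (h *m F ^+ m) =
    \sum_i berger f (eta i) (hk i) (hk i *m F).
  under [RHS]eq_bigr do rewrite bE [dot u _]dotC.
  rewrite bergerE // -/u !big_split /= -dot_suml -rmorph_sum -dot_suml hkS.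
  rewrite -mulr_suml sumrB (poisson_sum m0 f1 eta1 etam eta0) sumr_const card_ord.
  by rewrite dotZl rmorphM rmorph_nat /= -[(dot h u)^*]dotC; ring.
rewrite -(pmulr_rgt0 _ (_ : 0 < m%:R)) ?ltr0n // mh lt_neqAle sumr_ge0 // andbT eq_sym.
(* A zero sum would make every [hk i] vanish, hence also their mean [h]. *)
apply/eqP => /eqP; rewrite psumr_eq0 // => /allP b0.
have hk0 (i : 'I_m) : hk i = 0.
  apply/eqP/negPn/negP => /bF/(_ (eta1 i)).
  by rewrite (eqP (implyP (b0 i (mem_index_enum i)) isT)) ltxx.
move: hkS; under eq_bigr do rewrite hk0; rewrite big1 // => /esym/eqP.
by rewrite scaler_eq0 (negPf h0) pnatr_eq0 -leqn0 leqNgt m0.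
Qed.

End HermitianForm.

(** * The constant 2 for powers of Moebius maps *)

Section NumericalRadiusBound.
Context {R : rcfType} {n : nat} (dot : 'rV[R[i]]_n.+1 -> 'rV[R[i]]_n.+1 -> R[i]).
Hypothesis dotDl : forall u v w, dot (u + v) w = dot u w + dot v w.
Hypothesis dotZl : forall a u w, dot (a *: u) w = a * dot u w.
Hypothesis dotC : forall u v, dot v u = (dot u v)^*.
Hypothesis dot_gt0 : forall v, v != 0 -> 0 < dot v v.
Local Notation V := 'rV[R[i]]_n.+1.
Local Notation M := 'M[R[i]]_n.+1.
Local Notation dotE := (dotE dotDl dotZl dotC).
Local Notation berger_pos := (berger_pos dot).
Implicit Types (k l : V) (f t a : R[i]).

Lemma berger_pos0_Re (G : M) h t : berger_pos G 0 -> h != 0 -> `|t| = 1 ->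
  complex.Re (t * dot (h *m G) h) < complex.Re (dot h h).
Proof.
move=> bG h0 t1; have := bG h t h0 t1.
rewrite (berger0 dotDl dotZl dotC) // ltcE => /andP[_].
case: (t * _) => a b; case: (dot h h) => c d /= H; lra.
Qed.

(* Testing [G] on [a *: k + l] for the four pairs (t, a) equal to (1, (1 + u) / s),
   (-1, - (1 - u) / s), ('i, - 'i), (- 'i, 'i) with weights s, s, 1, 1, where
   s ^ 2 = 1 - u ^ 2, cancels the unknown entries dot (l G) k and dot (l G) l. *)
Lemma berger_pos0_offdiag (G : M) k l (u v : R) : berger_pos G 0 ->
  dot k k = 1 -> dot l l = 1 -> dot l k = 0 ->
  k *m G = (u%:C)%C *: k + (v%:C)%C *: l -> 0 <= u ->
  u < 1 /\ v <= 1 + Num.sqrt (1 - u ^+ 2).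
Proof.
move=> bG kk ll lk kG u0.
have kl : dot k l = 0 by rewrite dotC lk rmorph0.
have k0 : k != 0 by apply: contra_eq_neq kk => ->; rewrite (dot0l dotZl) eq_sym oner_eq0.
have u1 : u < 1.
  have := berger_pos0_Re bG k0 (normr1 _); rewrite kG !dotE kk lk /= !mulr0 addr0 !mulr1 mul1r.
  by move=> H; lra.
split=> //.
case bE : (dot (l *m G) k) => [b1 b2]; case dE : (dot (l *m G) l) => [d1 d2].
have test (t a : R[i]) : `|t| = 1 ->
    complex.Re (t * (a * a^* * (u%:C)%C + a * (v%:C)%C + a^* * (b1 +i* b2)%C + (d1 +i* d2)%C))
    < complex.Re (a * a^* + 1).
  move=> t1; have h0 : a *: k + l != 0.
    apply/eqP => /(congr1 (dot^~ l)); rewrite !dotE kl ll (dot0l dotZl) mulr0 add0r.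
    by apply/eqP; rewrite oner_eq0.
  have := berger_pos0_Re bG h0 t1.
  rewrite !mulmxDl -!scalemxAl kG !dotE kk ll lk kl bE dE.
  congr (complex.Re _ < complex.Re _); ring.
set s := Num.sqrt _.
have s2 : s ^+ 2 = 1 - u ^+ 2 by rewrite sqr_sqrtr; nra.
have s0 : 0 < s by rewrite sqrtr_gt0; nra.
have nN1 : `|-1 : R[i]| = 1 by rewrite normrN normr1.
have ni : `|(0 +i* 1)%C : R[i]| = 1 by rewrite normc_def /= expr0n expr1n add0r sqrtr1.
have nNi : `|- (0 +i* 1)%C : R[i]| = 1 by rewrite normrN.
have H1 := test 1 (((1 + u) / s)%:C)%C (normr1 _).
have H2 := test (-1) (- ((1 - u) / s)%:C)%C nN1.
have H3 := test (0 +i* 1)%C (- (0 +i* 1)%C) ni.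
have H4 := test (- (0 +i* 1)%C) (0 +i* 1)%C nNi.
move: H1 H2 H3 H4 => /=.
set p := (1 + u) / s; set q := (1 - u) / s => H1 H2 H3 H4.
have sp : s * p = 1 + u by rewrite mulrC divfK ?gt_eqF.
have sq : s * q = 1 - u by rewrite mulrC divfK ?gt_eqF.
have pp : p ^+ 2 * (1 - u) = 1 + u.
  have : s ^+ 2 * (p ^+ 2 * (1 - u)) = (1 + u) ^+ 2 * (1 - u).
    by rewrite mulrA -exprMn sp.
  have -> : (1 + u) ^+ 2 * (1 - u) = s ^+ 2 * (1 + u) by rewrite s2; ring.
  by apply: mulfI; rewrite s2; apply: lt0r_neq0; nra.
have qq : q ^+ 2 * (1 + u) = 1 - u.
  have : s ^+ 2 * (q ^+ 2 * (1 + u)) = (1 - u) ^+ 2 * (1 + u).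
    by rewrite mulrA -exprMn sq.
  have -> : (1 - u) ^+ 2 * (1 + u) = s ^+ 2 * (1 - u) by rewrite s2; ring.
  by apply: mulfI; rewrite s2; apply: lt0r_neq0; nra.
have K1 : 0 < 2 + u - (p * v + p * b1 + d1) by lra.
have K2 : 0 < 2 - u - (q * v + q * b1 - d1) by lra.
have K12 := addr_gt0 (mulr_gt0 s0 K1) (mulr_gt0 s0 K2).
have E12 : s * (2 + u - (p * v + p * b1 + d1)) + s * (2 - u - (q * v + q * b1 - d1)) =
  4 * s - (s * p + s * q) * (v + b1) by ring.
rewrite E12 sp sq in K12; lra.
Qed.

(** Splitting z = k G into u k + v l with l a unit vector orthogonal to k, the bound v <= 1 + s with
    s^2 = 1 - u^2 gives |z|^2 = u^2 + v^2 <= 2 + 2 s. The rest is an inequality between real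
    numbers. *)
Lemma berger_pos0_affine_normalized (G : M) f k (u : R) : berger_pos G 0 ->
  `|f| < 1 -> dot k k = 1 -> dot (k *m G) k = (u%:C)%C -> 0 <= u ->
  dot (k *m G + f *: k) (k *m G + f *: k) <=
  4 * dot (k + f^* *: (k *m G)) (k + f^* *: (k *m G)).
Proof.
move=> bG f1 kk zk u0; set z := k *m G in zk *.
have kz : dot k z = (u%:C)%C by rewrite dotC zk -[_^*]/(conjc _) conjc_real.
have zz0 := dot_ge0 dotZl dot_gt0 z.
have X0 := dot_ge0 dotZl dot_gt0 (k + f^* *: z).
have uu1 : u < 1.
  have k0 : k != 0 by apply: contra_eq_neq kk => ->; rewrite (dot0l dotZl) eq_sym oner_eq0.
  by have := berger_pos0_Re bG k0 (normr1 _); rewrite kk mul1r -/z zk.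
move: zz0; case zzE : (dot z z) => [g g']; rewrite lecE => /andP[/= /eqP g'0 g0].
rewrite g'0 in zzE => {g' g'0}.
have bound : g <= 2 + 2 * Num.sqrt (1 - u ^+ 2).
  pose l0 := z - (u%:C)%C *: k.
  have l0k : dot l0 k = 0 by rewrite !dotE zk kk; ring.
  have l0l0 : dot l0 l0 = ((g - u ^+ 2)%:C)%C.
    rewrite !dotE zk kk zzE kz -[((u%:C)%C)^*]/(conjc _) conjc_real.
    by apply/eqP; rewrite eq_complex /=; apply/andP; split; apply/eqP; ring.
  set s := Num.sqrt _; have s0 : 0 <= s by rewrite sqrtr_ge0.
  have s2 : s ^+ 2 = 1 - u ^+ 2 by rewrite sqr_sqrtr; nra.
  (* In the first case [l0] cannot be normalized, but then g <= u^2 < 1 is small enough. *)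
  have [gu|gu] := lerP g (u ^+ 2); first by nra.
  pose v := Num.sqrt (g - u ^+ 2).
  have v0 : 0 < v by rewrite sqrtr_gt0 subr_gt0.
  have v2 : v ^+ 2 = g - u ^+ 2 by rewrite sqr_sqrtr; nra.
  pose l := ((v^-1)%:C)%C *: l0.
  have ll : dot l l = 1.
    rewrite dotZl (dotZr dotZl dotC) l0l0 -[Num.conj _]/(conjc _) conjc_real -!rmorphM /= -v2.
    by rewrite mulrA -invfM -expr2 mulVf // lt0r_neq0 // exprn_gt0.
  have lk : dot l k = 0 by rewrite dotZl l0k mulr0.
  have kG : k *m G = (u%:C)%C *: k + (v%:C)%C *: l.
    by rewrite scalerA -rmorphM /= divff ?lt0r_neq0 // scale1r addrC subrK.
  have [_ vs] := berger_pos0_offdiag bG kk ll lk kG u0.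
  by rewrite -/s in vs; nra.
move: X0; rewrite !dotE conjCK zk kz kk zzE => X0.
case: f f1 X0 => a b; rewrite -[Num.conj _]/(conjc _) => f1 X0.
have r1 : a ^+ 2 + b ^+ 2 < 1.
  move: f1; rewrite normc_def ltcR /= => f1.
  by rewrite -ltr_sqrt // sqrtr1.
move: X0; rewrite !lecE /= => /andP[_ X0]; apply/andP; split; first by apply/eqP; ring.
set s := Num.sqrt _ in bound; have s0 : 0 <= s by rewrite sqrtr_ge0.
have s2 : s ^+ 2 = 1 - u ^+ 2 by rewrite sqr_sqrtr; nra.
set r := a ^+ 2 + b ^+ 2 in r1.
(* The right side minus the left, affine in g with slope 4 r - 1. For g <= 1 it equals 3 |k + f^*
   z|^2 + (1 - g) (1 - r). Beyond that, the sign of the slope decides whether g = 1 or g = 2 + 2 s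
   is the worst case. *)
suff : 0 <= 4 - g + r * (4 * g - 1) + 6 * a * u by rewrite /r; nra.
have r0 : a ^+ 2 <= r by rewrite /r; nra.
have [g1|g1] := lerP g 1.
  have : 0 <= 1 + 2 * a * u + r * g by move: X0; rewrite /r; nra.
  nra.
have [r4|r4] := lerP 1 (4 * r).
  (* At g = 1 the value is 3 ((a + u)^2 + (1 - u^2) + (r - a^2)). *)
  have h1 : 0 <= (4 * r - 1) * (g - 1) by apply: mulr_ge0; lra.
  have h2 := sqr_ge0 (a + u).
  have h3 : 0 <= 1 - u ^+ 2 by rewrite -s2 sqr_ge0.
  lra.
have h1 : 0 <= (1 - 4 * r) * (2 + 2 * s - g) by apply: mulr_ge0; lra.
(* As (1 - s) (1 + s) = u^2, the product is 2 (u + 3/2 a (1 + s))^2 + 9/2 (r - a^2) (1 + s)^2. *)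
have h2 : 0 <= (1 + s) * (2 * (1 - s) + 9 / 2 * r * (1 + s) + 6 * a * u).
  have := sqr_ge0 (u + 3 / 2 * a * (1 + s)).
  have : 0 <= (r - a ^+ 2) * (1 + s) ^+ 2 by rewrite mulr_ge0 ?sqr_ge0 ?subr_ge0.
  by move=> h3 h4; lra.
have s1 : 0 < 1 + s by lra.
rewrite pmulr_rge0 // in h2.
have h3 : 0 <= r * (5 + 7 * s) by rewrite mulr_ge0 /r ?addr_ge0 ?sqr_ge0 //; lra.
lra.
Qed.

(** Replacing (G, f, k) by (th G, th f, c k) with |th| = 1 multiplies both sides by |c|^2. So k may
    be taken of norm 1 and the inner product of k G with k real and nonnegative. *)
Lemma berger_pos0_affine (G : M) f k : berger_pos G 0 -> `|f| < 1 ->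
  dot (k *m G + f *: k) (k *m G + f *: k) <=
  4 * dot (k + f^* *: (k *m G)) (k + f^* *: (k *m G)).
Proof.
move=> bG f1; have [->|k0] := eqVneq k 0.
  by rewrite mul0mx !scaler0 !addr0 (dot0l dotZl) mulr0.
have kk0 := dot_gt0 k0.
pose c := (sqrtC (dot k k))^-1.
have c0 : 0 < c by rewrite invr_gt0 sqrtC_gt0.
have cc : c * c^* = (dot k k)^-1.
  rewrite -normCK ger0_norm ?(ltW c0) // exprVn.
  by rewrite sqrtCK.
pose d := dot (k *m G) k / dot k k.
pose th : R[i] := if d == 0 then 1 else `|d| / d.
have th1 : `|th| = 1.
  rewrite /th; case: eqVneq => [_|d0]; first exact: normr1.
  by rewrite normrM normfV normr_id divff ?normr_eq0.
have thd : th * d = `|d|.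
  by rewrite /th; case: eqVneq => [->|d0]; rewrite ?mulr0 ?normr0 ?divfK.
have bG' : berger_pos (th *: G) 0.
  move=> h t h0 t1; have := bG h (t * th) h0.
  rewrite -scalemxAr !(berger0 dotDl dotZl dotC) ?normrM ?t1 ?th1 ?mulr1 //.
  by rewrite dotZl mulrA; apply.
have := @berger_pos0_affine_normalized (th *: G) (th * f) (c *: k) (complex.Re `|d|) bG'.
have Nd : ((complex.Re `|d|)%:C)%C = `|d| by rewrite RRe_real ?normr_real.
rewrite Nd normrM th1 mul1r => /(_ f1).
have -> : dot (c *: k) (c *: k) = 1.
  by rewrite dotZl (dotZr dotZl dotC) mulrA cc mulVf ?lt0r_neq0.
have -> : dot (c *: k *m (th *: G)) (c *: k) = `|d|.
  rewrite -scalemxAr -scalemxAl !dotZl (dotZr dotZl dotC).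
  by rewrite -thd /d -cc; ring.
have -> : c *: k *m (th *: G) + th * f *: (c *: k) = (c * th) *: (k *m G + f *: k).
  rewrite -scalemxAr -scalemxAl scalerDr !scalerA; congr (_ *: _ + _ *: _); ring.
have -> : c *: k + (th * f)^* *: (c *: k *m (th *: G)) = c *: (k + f^* *: (k *m G)).
  rewrite -scalemxAr -scalemxAl scalerDr !scalerA rmorphM /= (unimodular_conj th1).
  congr (_ + _ *: _); by field; apply: unimodular_neq0.
move=> /(_ erefl erefl); rewrite -ler0c Nd normr_ge0 => /(_ isT).
rewrite !dotZl !(dotZr dotZl dotC) !mulrA rmorphM mulrA /=.
have -> : c * th * c^* * th^* = c * c^*.
  by rewrite (unimodular_conj th1); field; apply: unimodular_neq0.
have -> : 4 * c * c^* = c * c^* * 4 by ring.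
rewrite -[_ * 4 * _]mulrA cc ler_pM2l // invr_gt0 //.
Qed.

(* The Okubo-Ando constant 2, for powers of Moebius maps of the disk. *)
Theorem numrad_moebius_exp (A T : M) f m k :
  (forall v, v != 0 -> `|dot (v *m A) v| < dot v v) -> `|f| < 1 -> (0 < m)%N ->
  T = (1 + f^* *: A)^-1 * (A + f%:M) ->
  dot (k *m T ^+ m) (k *m T ^+ m) <= 4 * dot k k.
Proof.
move=> wA f1 m0 TE.
have uA : 1 + f^* *: A \is a GRing.unit.
  by apply: (numrad_unit dotDl dotZl dot_gt0) => //; rewrite norm_conjC.
have bT : berger_pos T f.
  by rewrite TE; apply: berger_pos_moebius => //; apply: numrad_berger_pos.
have bF := berger_pos_exp dotDl dotZl dotC m0 f1 bT.
set F := T ^+ m in bF *; set g := f ^+ m in bF.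
have g1 : `|g| < 1 by rewrite normrX exprn_ilt1 ?normr_ge0 // -lt0n.
have bG := berger_pos_moebiusV dotDl dotZl dotC g1 bF.
have uF := berger_pos_unit dotDl dotZl dotC g1 bF.
(* The row k' = k (1 - g^* F) is chosen so that k' G + g k' = (1 - |g|^2) k F and k' + g^* k' G = (1
   - |g|^2) k: the affine bound then compares k F with k. *)
have := berger_pos0_affine (k *m (1 - g^* *: F)) bG g1.
have -> : k *m (1 - g^* *: F) *m ((1 - g^* *: F)^-1 * (F - g%:M)) = k *m F - g *: k.
  rewrite mulmxA -(mulmxA k) -[(1 - _) *m _]/((1 - _) * _) mulrV // mulmx1.
  by rewrite mulmxBr mul_mx_scalar.
rewrite mulmxBr mulmx1 -scalemxAr.
set z := k *m F; set c := 1 - g * g^*.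
have -> : z - g *: k + g *: (k - g^* *: z) = c *: z.
  by rewrite scalerBr scalerA /c scalerBl scale1r addrA subrK.
have -> : k - g^* *: z + g^* *: (z - g *: k) = c *: k.
  by rewrite scalerBr scalerA /c scalerBl scale1r addrA subrK [g * _]mulrC.
have c0 : 0 < c by rewrite sub1_mulCK_gt0.
have cc0 : 0 < c * c^* by rewrite -normCK exprn_gt0 // normr_gt0 lt0r_neq0.
have cE y : dot (c *: y) (c *: y) = c * c^* * dot y y.
  by rewrite dotZl (dotZr dotZl dotC) mulrA.
by rewrite !cE mulrCA ler_pM2l.
Qed.

End NumericalRadiusBound.

(** * The compressed shift on polynomials modulo [N] *)

Lemma size_linear_exp (F : idomainType) (p : {poly F}) k :
  (size p <= 2)%N -> (size (p ^+ k)%R <= k.+1)%N.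
Proof.
move=> p2; apply: leq_trans (size_poly_exp_leq _ _) _.
by rewrite ltnS -[X in (_ <= X)%N]mul1n leq_mul2r; apply/orP; right; lia.
Qed.

Lemma size_mul_linear_exp (F : idomainType) (p q : {poly F}) k j :
  (size p <= 2)%N -> (size q <= 2)%N -> (size (p ^+ k * q ^+ j)%R <= (k + j).+1)%N.
Proof.
move=> /(size_linear_exp k) pk /(size_linear_exp j) qj.
by apply: leq_trans (size_polyMleq _ _) _; lia.
Qed.

Section ShiftForm.
Context {R : rcfType} {n : nat} (phi : {poly R[i]} -> {poly R[i]} -> R[i]) (N : {poly R[i]}).
Hypothesis phiDl : forall p q r, phi (p + q) r = phi p r + phi q r.
Hypothesis phiZl : forall a p r, phi (a *: p) r = a * phi p r.
Hypothesis phiC : forall p q, phi q p = (phi p q)^*.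
Hypothesis phi_gt0 : forall p, p != 0 -> 0 < phi p p.
Hypothesis phiX : forall p q, phi ('X * p) ('X * q) = phi p q.
Hypotheses (N_monic : N \is monic) (sizeN : size N = n.+2).
Hypothesis phiN : forall r : {poly R[i]}, (size r <= n.+1)%N -> phi N r = 0.
Local Notation C := R[i].
Local Notation V := 'rV[C]_n.+1.
Implicit Types (p q r : {poly C}) (v w : V) (a : C).

Let phiDr p q r : phi r (p + q) = phi r p + phi r q.
Proof. by rewrite phiC phiDl rmorphD /= -!phiC. Qed.
Let phiZr a p r : phi r (a *: p) = a^* * phi r p.
Proof. by rewrite phiC phiZl rmorphM /= -phiC. Qed.
Let phiNl p r : phi (- p) r = - phi p r.
Proof. by rewrite -scaleN1r phiZl mulN1r. Qed.
Let phiNr p r : phi r (- p) = - phi r p.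
Proof. by rewrite phiC phiNl rmorphN /= -phiC. Qed.
Let phiE := (phiDl, phiDr, phiZl, phiZr, phiNl, phiNr).

(** Strict Cauchy-Schwarz for the isometry X: by degree, X p is not a multiple of p. The multiple
    [t *: p] is the projection of X p onto p. *)
Lemma shift_form_lt p : p != 0 -> `|phi ('X * p) p| < phi p p.
Proof.
move=> p0; have pp := phi_gt0 p0; set c := phi ('X * p) p.
pose t := c / phi p p.
have q0 : 'X * p - t *: p != 0.
  rewrite subr_eq0; apply/eqP => /(congr1 (fun q : {poly C} => size q)).
  rewrite mulrC size_mulX // => E; have := size_scale_leq t p.
  by rewrite -E ltnn.
have := phi_gt0 q0; rewrite !phiE phiX (phiC ('X * p) p) -/c.
have tc : t^* = c^* / phi p p.
  by rewrite rmorphM fmorphV /= (geC0_conj (ltW pp)).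
have -> : phi p p - t^* * c - (t * c^* - t^* * (t * phi p p)) =
    phi p p - c * c^* / phi p p.
  by rewrite tc /t; field; rewrite lt0r_neq0.
by rewrite subr_gt0 ltr_pdivrMr // -normCK -expr2 ltr_pXn2r ?nnegrE ?normr_ge0 ?(ltW pp).
Qed.

(** Multiplication by X modulo [N] on coefficient rows; only X^(n+1), in the last row, has to be
    reduced. Since [N] is orthogonal to all degrees up to n, this is also the compression of
    multiplication by X. *)
Definition shift_mx : 'M[C]_n.+1 :=
  \matrix_(i < n.+1) poly_rV ('X * 'X^i - (i == ord_max)%:R *: N).

Lemma rVpoly_shift v : rVpoly (v *m shift_mx) = 'X * rVpoly v - v 0 ord_max *: N.
Proof.
rewrite mulmx_sum_row linear_sum /=.
have -> : rVpoly v = \sum_i v 0 i *: 'X^i.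
  apply/polyP => k; rewrite coef_rVpoly coef_sum.
  case: insubP => [i _ <-|ik]; last first.
    rewrite big1 // => j _; rewrite coefZ coefXn; case: eqP => [kj|_]; last by rewrite mulr0.
    by rewrite kj ltn_ord in ik.
  rewrite (bigD1 i) //= coefZ coefXn eqxx mulr1 big1 ?addr0 // => j /negP ji.
  rewrite coefZ coefXn; case: eqP => [/val_inj ij|_]; last by rewrite mulr0.
  by case: ji; rewrite ij.
have -> : v 0 ord_max *: N = \sum_i v 0 i *: ((i == ord_max :> 'I_n.+1)%:R *: N).
  rewrite (bigD1 ord_max) //= eqxx scale1r big1 ?addr0 // => i /negPf ->.
  by rewrite scale0r scaler0.
rewrite mulr_sumr -sumrB; apply: eq_bigr => i _.
rewrite linearZ /= rowK poly_rV_K; last first.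
  rewrite -exprS; case: eqP => [->|/eqP im]; last first.
    rewrite scale0r subr0 size_polyXn ltnS ltn_neqAle -ltnS ltn_ord andbT.
    by apply: contra im => /eqP im; apply/eqP/val_inj.
  rewrite scale1r; apply/leq_sizeP => j; rewrite leq_eqVlt => /orP[/eqP <-|nj].
    rewrite coefB coefXn eqxx; have := monicP N_monic.
    by rewrite lead_coefE sizeN /= => ->; rewrite subrr.
  by rewrite coefB coefXn gtn_eqF // sub0r nth_default ?oppr0 // sizeN.
by rewrite scalerBr scalerAr.
Qed.

Definition row_form v w := phi (rVpoly v) (rVpoly w).

Lemma row_formDl u v w : row_form (u + v) w = row_form u w + row_form v w.
Proof. by rewrite /row_form linearD phiDl. Qed.
Lemma row_formZl a u w : row_form (a *: u) w = a * row_form u w.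
Proof. by rewrite /row_form linearZ phiZl. Qed.
Lemma row_formC u v : row_form v u = (row_form u v)^*.
Proof. exact: phiC. Qed.
Lemma row_form_gt0 v : v != 0 -> 0 < row_form v v.
Proof.
by move=> v0; apply: phi_gt0; apply: contraNneq v0 => E; rewrite -[v]rVpolyK E linear0.
Qed.

Lemma row_form_shift v w : row_form (v *m shift_mx) w = phi ('X * rVpoly v) (rVpoly w).
Proof. by rewrite /row_form rVpoly_shift !phiE phiN ?size_poly // mulr0 subr0. Qed.

Lemma row_form_shift_lt v : v != 0 -> `|row_form (v *m shift_mx) v| < row_form v v.
Proof.
move=> v0; rewrite row_form_shift; apply: shift_form_lt.
by apply: contraNneq v0 => E; rewrite -[v]rVpolyK E linear0.
Qed.

(** The polynomial form of |x - z| = |1 - z^* x| for |x| = 1: as X is isometric, both sides have the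
    same expansion. *)
Lemma shift_form_moebius z p : 
  phi (('X - z%:P) * p) (('X - z%:P) * p) =
  phi ((1 - z^* *: 'X) * p) ((1 - z^* *: 'X) * p).
Proof.
by rewrite !mulrBl !mul1r -!scalerAl !mul_polyC !phiE phiX conjCK; ring.
Qed.

Theorem row_form_unicritical_bound z0 rho m : `|z0| < 1 -> 0 < rho -> rho < 1 ->
  (0 < m <= n)%N ->
  (forall v, v != 0 -> let z := row_form (v *m shift_mx) v / row_form v v in
     `|z - z0| < rho * `|1 - z0^* * z|) ->
  2^-1 <= rho ^+ m.
Proof.
move=> z1 r0 r1 /andP[m0 mn] W.
have rho_conj : rho^* = rho by rewrite geC0_conj // ltW.
have rz : rho ^+ 2 * (z0 * z0^*) < 1.
  rewrite -normCK -exprMn exprn_ilt1 ?mulr_ge0 ?normr_ge0 ?(ltW r0) //.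
  by rewrite mulr_ilt1 ?normr_ge0 ?(ltW r0).
have [D DE] : exists D, D = 1 - rho ^+ 2 * (z0 * z0^*) by eexists.
have D0 : 0 < D by rewrite DE subr_gt0.
have D_conj : D^* = D by rewrite geC0_conj // ltW.
have d0 := sub1_mulCK_gt0 z1.
pose kap := (1 - z0 * z0^*) / D; pose rad := rho * kap.
have kap0 : 0 < kap by rewrite divr_gt0.
have rad0 : 0 < rad by rewrite mulr_gt0.
(* [c] and [rad] are the Euclidean centre and radius of the disk |z - z0| < rho |1 - z0^* z|. *)
pose c := z0 * (1 - rho ^+ 2) / D.
have [A AE] : exists A, A = rad^-1 *: (shift_mx - c%:M) by eexists.
(* The value at the centre [c] of the Moebius map (z - z0) / (1 - z0^* z), divided by rho. *)
pose f := - (rho * z0).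
have f1 : `|f| < 1.
  by rewrite normrN normrM mulr_ilt1 ?normr_ge0 // ger0_norm // ltW.
have wA v : v != 0 -> `|row_form (v *m A) v| < row_form v v.
  move=> v0; have vv := row_form_gt0 v0; have := W v v0.
  have -> : row_form (v *m A) v = row_form v v *
     ((row_form (v *m shift_mx) v / row_form v v - c) / rad).
    rewrite AE -scalemxAr row_formZl mulmxBr mul_mx_scalar -scaleN1r row_formDl !row_formZl.
    by field; rewrite !lt0r_neq0.
  rewrite normrM ger0_norm ?(ltW vv) //=; move: (_ / row_form v v) => z zr.
  rewrite gtr_pMr // normrM normfV (ger0_norm (ltW rad0)) ltr_pdivrMr // mul1r.
  rewrite -(ltr_pXn2r (n := 2)) ?nnegrE ?normr_ge0 ?(ltW rad0) // -subr_gt0.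
  have -> : rad ^+ 2 - `|z - c| ^+ 2 =
     ((rho * `|1 - z0^* * z|) ^+ 2 - `|z - z0| ^+ 2) / D.
    rewrite !exprMn !normCK /rad /kap /c.
    rewrite !(rmorphB, rmorphM, rmorph1, fmorphV, rmorphXn) /= D_conj rho_conj ?conjCK.
    have := lt0r_neq0 D0; rewrite DE; move: (z0^*) (z^*) => w0 w Dn0.
    by field.
  rewrite divr_gt0 // subr_gt0 ltr_pXn2r // ?nnegrE ?normr_ge0 //.
  by rewrite mulr_ge0 ?normr_ge0 // ltW.
pose T := (1 + f^* *: A)^-1 * (A + f%:M).
have uA : 1 + f^* *: A \is a GRing.unit.
  by apply: (numrad_unit row_formDl row_formZl row_form_gt0) => //; rewrite norm_conjC.
have SA : shift_mx = rad *: A + c%:M.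
  by rewrite AE scalerA divff ?lt0r_neq0 // scale1r subrK.
(* This is rho T = (S - z0) / (1 - z0^* S) without the inverse. *)
have step v : rho *: ((v - z0^* *: (v *m shift_mx)) *m T) = v *m shift_mx - z0 *: v.
  have -> : v - z0^* *: (v *m shift_mx) = kap *: (v *m (1 + f^* *: A)).
    rewrite SA !mulmxDr mulmx1 mul_mx_scalar -!scalemxAr scalerDr !scalerA.
    rewrite scalerDr scalerA opprD addrCA addrC; congr (_ + _); last first.
      rewrite -scaleNr; congr (_ *: _).
      by rewrite /f rmorphN rmorphM /= rho_conj /rad; ring.
    rewrite -{1}[v]scale1r -scalerBl; congr (_ *: _).
    rewrite /kap /c; have := lt0r_neq0 D0; rewrite DE => Dn0.
    by field.
  rewrite -scalemxAl -mulmxA -[(1 + _) *m T]/((1 + _) * T) mulVKr // scalerA.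
  rewrite mulmxDr mul_mx_scalar scalerDr SA mulmxDr mul_mx_scalar -scalemxAr -addrA -scalerBl.
  rewrite -/rad scalerA; congr (_ + _ *: _).
  rewrite /rad /kap /c /f; have := lt0r_neq0 D0; rewrite DE => Dn0.
  by field.
(* [v k] below is P k (n - k): passing to [v k.+1] exchanges a factor 1 - z0^* X for X - z0, which
   is an application of rho T and preserves the norm. *)
pose P k j := ('X - z0%:P) ^+ k * (1 - z0^* *: 'X) ^+ j.
have size1 : (size (1 - z0^* *: 'X : {poly C})%R <= 2)%N.
  rewrite (leq_trans (size_polyD _ _)) // geq_max size_poly1 size_polyN.
  by rewrite (leq_trans (size_scale_leq _ _)) // size_polyX.
have sizeP k j : (size (P k j) <= (k + j).+1)%N.
  by apply: size_mul_linear_exp => //; rewrite size_XsubC.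
pose v k := poly_rV (P k (n - k)%N) : V.
have vK k : (k <= n)%N -> rVpoly (v k) = P k (n - k)%N.
  by move=> kn; rewrite poly_rV_K // (leq_trans (sizeP _ _)) // subnKC.
have vS k : (k < n)%N -> v k.+1 = rho *: (v k *m T).
  (* The common factor [y] of [v k] and [v k.+1] has degree at most n - 1, so y S = X y holds
     without reduction modulo [N]. *)
  move=> kn; pose y := poly_rV (P k (n - k.+1)%N) : V.
  have ysz : (size (P k (n - k.+1)%N) <= n)%N by rewrite (leq_trans (sizeP _ _)) // -addSn subnKC.
  have yK : rVpoly y = P k (n - k.+1)%N by rewrite poly_rV_K // (leq_trans ysz).
  have yS : rVpoly (y *m shift_mx) = 'X * P k (n - k.+1)%N.
    by rewrite rVpoly_shift yK mxE nth_default // scale0r subr0.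
  have -> : v k = y - z0^* *: (y *m shift_mx).
    apply: (can_inj rVpolyK); rewrite vK ?(ltnW kn) // linearB linearZ /= yS yK.
    by rewrite /P -(subnSK kn) exprS -!mul_polyC; ring.
  rewrite step; apply: (can_inj rVpolyK); rewrite vK // linearB linearZ /= yS yK.
  by rewrite /P exprS -!mul_polyC; ring.
have vT k : (k <= n)%N -> v k = rho ^+ k *: (v 0%N *m T ^+ k).
  elim: k => [|k IH] kn; first by rewrite expr0 scale1r mulmx1.
  rewrite vS // IH ?(ltnW kn) // -scalemxAl scalerA -exprS -mulmxA.
  by rewrite -[T ^+ k *m T]/(T ^+ k * T) -exprSr.
have v_norm k : (k <= n)%N -> row_form (v k) (v k) = row_form (v 0%N) (v 0%N).
  elim: k => [//|k IH] kn; rewrite -IH ?(ltnW kn) // /row_form !vK ?(ltnW kn) //.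
  rewrite /P exprS -(subnSK kn).
  rewrite -mulrA shift_form_moebius exprS mulrCA; congr (phi _ _); ring.
have v0 : v 0%N != 0.
  apply/eqP => /(congr1 rVpoly); rewrite vK // linear0 /P expr0 mul1r => /eqP.
  rewrite expf_eq0 => /andP[_] /eqP /(congr1 (fun q : {poly C} => q.[0])).
  by rewrite !hornerE ?mulr0 ?subr0 => /eqP; rewrite oner_eq0.
have := numrad_moebius_exp row_formDl row_formZl row_formC row_form_gt0 (v 0%N) wA f1 m0 (erefl T).
have : row_form (v m) (v m) = (rho ^+ m) ^+ 2 * row_form (v 0%N *m T ^+ m) (v 0%N *m T ^+ m).
  rewrite vT // row_formZl (dotZr row_formZl row_formC) rmorphXn /= rho_conj mulrA.
  by rewrite -expr2.
rewrite v_norm // => E bound.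
have rm0 : 0 < rho ^+ m by rewrite exprn_gt0.
have vv := row_form_gt0 v0.
(* From |v_0| = |v_m| = rho^m |v_0 T^m| <= 2 rho^m |v_0|, squared. *)
have : 2^-1 ^+ 2 <= (rho ^+ m) ^+ 2.
  rewrite -(ler_pM2r vv) exprVn mulrC ler_pdivrMr ?exprn_gt0 ?ltr0n // {1}E -[X in _ <= X]mulrA.
  rewrite ler_pM2l ?exprn_gt0 //; apply: le_trans bound _.
  by rewrite mulrC -natrX.
by rewrite ler_pXn2r // nnegrE ?invr_ge0 ?ler0n // ltW.
Qed.

End ShiftForm.

(** * Absolutely summable series of complex numbers *)

Section ComplexSeries.
Context {R : realType}.
Local Notation C := (R[i]).
Implicit Types (c d : nat -> C) (l M z : C).

Definition has_sum c l := series (c : nat -> C^o) @ \oo --> (l : C^o).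
Definition csum c : C := limn (series (c : nat -> C^o)).

Lemma has_sum_csum c l : has_sum c l -> csum c = l.
Proof. by move=> cl; apply: (@cvg_lim C^o _ _ _ _ _ _ cl); exact: norm_hausdorff. Qed.

Lemma has_sum_unique c l l' : has_sum c l -> has_sum c l' -> l = l'.
Proof. by move=> /has_sum_csum <- /has_sum_csum. Qed.

Lemma has_sumP c l : has_sum c l <->
  (forall e : C, 0 < e -> exists N, forall n, (N <= n)%N -> `|l - \sum_(i < n) c i| < e).
Proof.
split=> [/cvgrPdist_lt cl e e0|cl].
  have [N _ NP] := cl e e0; exists N => n Nn.
  by have := NP n Nn; rewrite /series /= big_mkord.
apply/cvgrPdist_lt => e e0; have [N NP] := cl e e0; exists N => // n Nn.
by rewrite /series /= big_mkord; exact: NP.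
Qed.

Lemma has_sumD c d l l' : has_sum c l -> has_sum d l' ->
  has_sum (fun n => c n + d n) (l + l').
Proof.
move=> /has_sumP cl /has_sumP dl; apply/has_sumP => e e0.
have e2 : 0 < e / 2 by rewrite divr_gt0.
have [[N NP] [N' NP']] := (cl _ e2, dl _ e2); exists (maxn N N') => n.
rewrite geq_max => /andP[/NP nN /NP' nN'].
rewrite big_split opprD addrACA [e]splitr; apply: le_lt_trans (ler_normD _ _) _.
exact: ltrD.
Qed.

Lemma has_sumZ a c l : has_sum c l -> has_sum (fun n => a * c n) (a * l).
Proof.
move=> /has_sumP cl; apply/has_sumP => e e0; have a0 : 0 < `|a| + 1.
  by rewrite ltr_wpDl.
have [|N NP] := cl (e / (`|a| + 1)); first by rewrite divr_gt0.
exists N => n /NP nN; rewrite -mulr_sumr -mulrBr normrM.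
rewrite ltr_pdivlMr // mulrC in nN; apply: le_lt_trans nN.
by rewrite ler_wpM2r // lerDl.
Qed.

Lemma has_sum0 : has_sum (fun=> 0) 0.
Proof.
by apply/has_sumP => e e0; exists 0%N => n _; rewrite big1 // subr0 normr0.
Qed.

Lemma has_sum_conj c l : has_sum c l -> has_sum (fun n => (c n)^*) l^*.
Proof.
move=> /has_sumP cl; apply/has_sumP => e /cl[N NP]; exists N => n /NP.
by rewrite -rmorph_sum -rmorphB norm_conjC.
Qed.

Lemma has_sum_shift c l : has_sum (fun n => c n.+1) l -> has_sum c (c 0%N + l).
Proof.
move=> /has_sumP cl; apply/has_sumP => e /cl[N NP]; exists N.+1 => -[//|n] /NP.
by rewrite big_ord_recl opprD addrACA subrr add0r.
Qed.

(** The order on complex numbers is partial, so the limit must be shown to be real as well; l = |l|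
    gives both, by continuity of the modulus. *)
Lemma lim_ge0 (u : nat -> C) l :
  (forall e : C, 0 < e -> exists N, forall n, (N <= n)%N -> `|l - u n| < e) ->
  (forall n, 0 <= u n) -> 0 <= l.
Proof.
move=> ul u0; suff -> : l = `|l| by exact: normr_ge0.
apply/eqP; rewrite -subr_eq0 -normr_eq0; apply/eqP.
apply: contrapT => /eqP ll; have l0 : 0 < `|l - `|l| | / 2.
  by rewrite divr_gt0 // lt_def ll normr_ge0.
have [N /(_ N (leqnn _)) lN] := ul _ l0.
have : `|l - `|l| | <= `|l - u N| + `|l - u N|.
  have -> : l - `|l| = (l - u N) + (`|u N| - `|l|) by rewrite (ger0_norm (u0 N)) addrA subrK.
  apply: (le_trans (ler_normD _ _)); rewrite lerD2l.
  by apply: (le_trans (ler_dist_dist _ _)); rewrite distrC.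
have : `|l - u N| + `|l - u N| < `|l - `|l| |.
  by rewrite [ltRHS](splitr `|l - `|l| |) ltrD.
by move=> /lt_le_trans h /h; rewrite ltxx.
Qed.

Lemma has_sum_ge0 c l : has_sum c l -> (forall n, 0 <= c n) -> 0 <= l.
Proof. by move=> /has_sumP cl c0; apply: lim_ge0 cl _ => n; exact: sumr_ge0. Qed.

Definition bdsum c := exists M, forall n, \sum_(i < n) `|c i| <= M.

Lemma bdsum_le c d : bdsum d -> (forall n, `|c n| <= `|d n|) -> bdsum c.
Proof. by move=> [M dM] cd; exists M => n; apply: le_trans (dM n); exact: ler_sum. Qed.

Lemma bdsumD c d : bdsum c -> bdsum d -> bdsum (fun n => c n + d n).
Proof.
move=> [M cM] [M' dM]; exists (M + M') => n; apply: le_trans (lerD (cM n) (dM n)).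
by rewrite -big_split; apply: ler_sum => i _; exact: ler_normD.
Qed.

Lemma bdsumZ a c : bdsum c -> bdsum (fun n => a * c n).
Proof.
move=> [M cM]; exists (`|a| * M) => n; under eq_bigr do rewrite normrM.
by rewrite -mulr_sumr ler_wpM2l.
Qed.

Lemma bdsum_real_cvg (u : nat -> R) (M : R) :
  (forall n, \sum_(i < n) `|u i| <= M) -> cvgn (series u).
Proof.
move=> uM; apply: normed_cvg; apply: nondecreasing_is_cvgn.
  by apply: nondecreasing_series => n _ _; exact: normr_ge0.
exists M => _ [n _ <-]; have := uM n.
by rewrite -(big_mkord xpredT (fun i => `|u i|)).
Qed.

(** Completeness comes from the real numbers: the real and imaginary parts are absolutely
    summable. *)
Lemma bdsum_has_sum c : bdsum c -> exists l, has_sum c l.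
Proof.
move=> [M cM].
have rM : M \is Num.real.
  by apply: ger0_real; apply: le_trans (cM 0%N); rewrite big_ord0.
have bound (p : C -> R) : (forall z, (`|p z|%:C)%C <= `|z|) ->
    cvgn (series (fun n => p (c n))).
  move=> pz; apply: (@bdsum_real_cvg _ (complex.Re M)) => n.
  rewrite -lecR RRe_real // rmorph_sum; apply: le_trans (cM n).
  by apply: ler_sum => i _; exact: pz.
have /cvg_ex[a /cvgrPdist_lt aP] : cvgn (series (fun n => complex.Re (c n))).
  by apply: bound => z; exact: normc_ge_Re.
have /cvg_ex[b /cvgrPdist_lt bP] : cvgn (series (fun n => complex.Im (c n))).
  apply: bound => -[x y] /=; rewrite normc_def /= lecR -sqrtr_sqr.
  by rewrite ler_wsqrtr // lerDr sqr_ge0.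
exists (a +i* b)%C; apply/has_sumP => e e0.
have [r re] : exists r : R, e = (r%:C)%C.
  by exists (complex.Re e); rewrite RRe_real // ger0_real // ltW.
have r0 : 0 < r / 2 by rewrite divr_gt0 // -ltcR -re.
have [N _ NP] := aP _ r0; have [N' _ NP'] := bP _ r0.
exists (maxn N N') => n; rewrite geq_max => /andP[/NP nN /NP' nN'].
move: nN nN'; rewrite /series /= !big_mkord.
have -> : \sum_(i < n) c i =
    ((\sum_(i < n) complex.Re (c i)) +i* (\sum_(i < n) complex.Im (c i)))%C.
  elim: n => [|n IH]; first by rewrite !big_ord0.
  by rewrite !big_ord_recr IH /=; case: (c n).
move: (\sum_(i < n) _) (\sum_(i < n) _) => y x xa yb.
rewrite [X in `|X|](_ : _ = ((a - x)%:C)%C + (0 +i* (b - y))%C); last first.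
  by apply/eqP; rewrite eq_complex /= addr0 add0r !eqxx.
apply: (le_lt_trans (ler_normD _ _)); rewrite !normc_def /= expr0n addr0 add0r !sqrtr_sqr.
by rewrite re -rmorphD ltcR [ltRHS]splitr ltrD.
Qed.

End ComplexSeries.

(** * The inner product, backward shift and point evaluations of H^2 *)

Lemma sqr_sub_ge0 (K : numDomainType) (x y : K) : 0 <= x -> 0 <= y -> 0 <= (x - y) ^+ 2.
Proof. by move=> x0 y0; rewrite real_exprn_even_ge0 // realB // ger0_real. Qed.

Lemma mul_le_sqrD (K : numDomainType) (x y : K) :
  0 <= x -> 0 <= y -> x * y <= x ^+ 2 + y ^+ 2.
Proof.
move=> x0 y0; rewrite -subr_ge0.
have -> : x ^+ 2 + y ^+ 2 - x * y = (x - y) ^+ 2 + x * y by ring.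
by rewrite addr_ge0 ?sqr_sub_ge0 ?mulr_ge0.
Qed.

Lemma sqrD_le (K : numDomainType) (x y : K) :
  0 <= x -> 0 <= y -> (x + y) ^+ 2 <= 2 * (x ^+ 2 + y ^+ 2).
Proof.
move=> x0 y0; rewrite -subr_ge0.
have -> : 2 * (x ^+ 2 + y ^+ 2) - (x + y) ^+ 2 = (x - y) ^+ 2 by ring.
exact: sqr_sub_ge0.
Qed.

Section HardySpace.
Context {R : realType}.
Local Notation C := (R[i]).
Local Notation ip := (@H2_inner R).
Implicit Types (f g h u v : nat -> C) (a b z : C) (p q : {poly C}) (s : seq C).

Lemma H2P f : H2 f <-> bdsum (fun n => `|f n| ^+ 2).
Proof.
split=> [/cvg_ex[l fl]|/bdsum_has_sum[l fl]]; last by apply/cvg_ex; exists l.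
have {}fl : has_sum (fun n => `|f n| ^+ 2) l by exact: fl.
exists l => n; rewrite -subr_ge0.
have -> : l - \sum_(i < n) `|(`|f i| ^+ 2)| = l - \sum_(i < n) `|f i| ^+ 2.
  by congr (_ - _); apply: eq_bigr => i _; rewrite ger0_norm ?exprn_ge0.
(* The difference is the limit of sums of |f_i|^2 over blocks starting at n, which are
   nonnegative. *)
apply: (@lim_ge0 _ (fun k => \sum_(i < k + n) `|f i| ^+ 2 - \sum_(i < n) `|f i| ^+ 2)).
  move=> e e0; move: fl => /has_sumP fl.
  have [N NP] := fl e e0; exists N => k Nk; rewrite opprB addrA subrK.
  by apply: NP; rewrite (leq_trans Nk) ?leq_addr.
move=> k; rewrite subr_ge0 addnC big_split_ord /= lerDl.
by apply: sumr_ge0 => i _; rewrite exprn_ge0.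
Qed.

Lemma bdsum_inner f g : H2 f -> H2 g -> bdsum (fun n => f n * (g n)^*).
Proof.
move=> /H2P Hf /H2P Hg; apply: bdsum_le (bdsumD Hf Hg) _ => n.
rewrite normrM norm_conjC [leRHS]ger0_norm ?addr_ge0 ?exprn_ge0 //.
exact: mul_le_sqrD.
Qed.

Lemma inner_has_sum f g : H2 f -> H2 g -> has_sum (fun n => f n * (g n)^*) (ip f g).
Proof.
move=> Hf Hg; have [l fl] := bdsum_has_sum (bdsum_inner Hf Hg).
by rewrite /H2_inner -[limn _]/(csum _) (has_sum_csum fl).
Qed.

Lemma inner_eq f g l : has_sum (fun n => f n * (g n)^*) l -> ip f g = l.
Proof. exact: has_sum_csum. Qed.

Lemma H2D f g : H2 f -> H2 g -> H2 (fun n => f n + g n).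
Proof.
move=> /H2P Hf /H2P Hg; apply/H2P.
apply: bdsum_le (bdsumZ 2 (bdsumD Hf Hg)) _ => n.
rewrite [leLHS]ger0_norm ?[leRHS]ger0_norm ?mulr_ge0 ?addr_ge0 ?exprn_ge0 //.
apply: le_trans (sqrD_le _ _) => //; rewrite ler_pXn2r ?nnegrE ?addr_ge0 //.
exact: ler_normD.
Qed.

Lemma H2Z a f : H2 f -> H2 (fun n => a * f n).
Proof.
move=> /H2P Hf; apply/H2P; apply: bdsum_le (bdsumZ (`|a| ^+ 2) Hf) _ => n.
by rewrite (normrM a) exprMn.
Qed.

Lemma H2B f g : H2 f -> H2 g -> H2 (fun n => f n - g n).
Proof.
move=> Hf Hg; have := H2D Hf (H2Z (a := -1) Hg).
by congr (H2 _); apply/funext => n; rewrite mulN1r.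
Qed.

Lemma H2_mulz f : H2 f -> H2 (mulz f).
Proof.
move=> /H2P[M fM]; apply/H2P; exists M => -[|n].
  by rewrite big_ord0; apply: le_trans (fM 0%N); rewrite big_ord0.
by rewrite big_ord_recl /= normr0 expr0n normr0 add0r; exact: fM.
Qed.

Definition back f : nat -> C := fun n => f n.+1.

Lemma H2_back f : H2 f -> H2 (back f).
Proof.
move=> /H2P[M fM]; apply/H2P; exists M => n; apply: le_trans (fM n.+1).
by rewrite big_ord_recl lerDr.
Qed.

Lemma H2_finite f n : (forall k, (n <= k)%N -> f k = 0) -> H2 f.
Proof.
move=> f0; apply/H2P; exists (\sum_(i < n) `|(`|f i| ^+ 2)|) => k.
have S d : \sum_(i < n + d) `|(`|f i| ^+ 2)| = \sum_(i < n) `|(`|f i| ^+ 2)|.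
  rewrite big_split_ord /= [X in _ + X]big1 ?addr0 // => i _.
  by rewrite f0 ?leq_addr // normr0 expr0n normr0.
rewrite -(S k) addnC big_split_ord /= lerDl; exact: sumr_ge0.
Qed.

Lemma innerDl f g h : H2 f -> H2 g -> H2 h -> ip (fun n => f n + g n) h = ip f h + ip g h.
Proof.
move=> Hf Hg Hh; apply: inner_eq.
have := has_sumD (inner_has_sum Hf Hh) (inner_has_sum Hg Hh).
by congr (has_sum _ _); apply/funext => n; rewrite mulrDl.
Qed.

Lemma innerZl a f h : H2 f -> H2 h -> ip (fun n => a * f n) h = a * ip f h.
Proof.
move=> Hf Hh; apply: inner_eq; have := has_sumZ (a := a) (inner_has_sum Hf Hh).
by congr (has_sum _ _); apply/funext => n; rewrite mulrA.
Qed.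

Lemma innerC f g : H2 f -> H2 g -> ip g f = (ip f g)^*.
Proof.
move=> Hf Hg; apply: inner_eq; have := has_sum_conj (inner_has_sum Hf Hg).
by congr (has_sum _ _); apply/funext => n; rewrite rmorphM /= conjCK mulrC.
Qed.

Lemma innerBl f g h : H2 f -> H2 g -> H2 h -> ip (fun n => f n - g n) h = ip f h - ip g h.
Proof.
move=> Hf Hg Hh; have := innerDl Hf (H2Z (a := -1) Hg) Hh.
have -> : (fun n => f n + -1 * g n) = (fun n => f n - g n).
  by apply/funext => n; rewrite mulN1r.
by rewrite (innerZl _ Hg Hh) mulN1r.
Qed.

Lemma inner0l f : ip (fun=> 0) f = 0.
Proof.
apply: inner_eq; have := @has_sum0 R.
by congr (has_sum _ _); apply/funext => n; rewrite mul0r.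
Qed.

Lemma innerBr f g h : H2 f -> H2 g -> H2 h -> ip h (fun n => f n - g n) = ip h f - ip h g.
Proof.
move=> Hf Hg Hh; rewrite (innerC (H2B Hf Hg) Hh) (innerBl Hf Hg Hh) rmorphB /=.
by rewrite -(innerC Hf Hh) -(innerC Hg Hh).
Qed.

Lemma innerZr a f h : H2 f -> H2 h -> ip h (fun n => a * f n) = a^* * ip h f.
Proof.
by move=> Hf Hh; rewrite (innerC (H2Z (a := a) Hf) Hh) (innerZl a Hf Hh) rmorphM /= -(innerC Hf Hh).
Qed.

Lemma inner_mulz f g : H2 f -> H2 g -> ip (mulz f) g = ip f (back g).
Proof.
move=> Hf Hg; apply: inner_eq; rewrite -[ip _ _]add0r.
have := @has_sum_shift _ (fun n => mulz f n * (g n)^*) _ (inner_has_sum Hf (H2_back Hg)).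
by rewrite /= mul0r.
Qed.

Lemma inner_ge0 f : H2 f -> 0 <= ip f f.
Proof.
by move=> Hf; apply: has_sum_ge0 (inner_has_sum Hf Hf) _ => n; rewrite -normCK exprn_ge0.
Qed.

Lemma inner_back f g : H2 f -> H2 g -> ip f g = f 0%N * (g 0%N)^* + ip (back f) (back g).
Proof.
move=> Hf Hg; apply: has_sum_unique (inner_has_sum Hf Hg) _.
exact: (@has_sum_shift _ (fun n => f n * (g n)^*)) (inner_has_sum (H2_back Hf) (H2_back Hg)).
Qed.

Lemma inner_norm_ge f k : H2 f -> `|f k| ^+ 2 <= ip f f.
Proof.
elim: k f => [|k IH] f Hf; have Hb := H2_back Hf; rewrite (inner_back Hf Hf) -normCK.
  by rewrite lerDl inner_ge0.
by apply: le_trans (IH _ Hb) _; rewrite lerDr exprn_ge0.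
Qed.

(** A crude Cauchy-Schwarz inequality: expand |f - c g|^2 >= 0 with [c] the phase of the inner
    product. *)
Lemma inner_norm_le f g : H2 f -> H2 g -> `|ip f g| <= ip f f + ip g g.
Proof.
move=> Hf Hg; have [->|e0] := eqVneq (ip f g) 0.
  by rewrite normr0 addr_ge0 ?inner_ge0.
set e := ip f g in e0 *; pose c := e / `|e|.
have c1 : c * c^* = 1.
  by rewrite -normCK normrM normfV normr_id divff ?normr_eq0 // expr1n.
have ec : c^* * e = `|e|.
  rewrite /c rmorphM fmorphV /= (geC0_conj (normr_ge0 e)) mulrAC [e^* * e]mulrC -normCK.
  by rewrite expr2 -mulrA mulfV ?normr_eq0 // mulr1.
have Hcg := H2Z (a := c) Hg.
have := inner_ge0 (H2B Hf Hcg).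
rewrite (innerBl Hf Hcg (H2B Hf Hcg)) (innerBr Hf Hcg Hf) (innerBr Hf Hcg Hcg).
rewrite (innerZr c Hg Hf) (innerZl c Hg Hf) (innerZl c Hg Hcg) (innerZr c Hg Hg) (innerC Hf Hg) -/e ec.
have -> : c * e^* = `|e|.
  by rewrite -[LHS]conjCK rmorphM /= conjCK ec geC0_conj ?normr_ge0.
move=> h; rewrite -subr_ge0.
suff -> : ip f f + ip g g - `|e| = ip f f - `|e| - (`|e| - c * (c^* * ip g g)) + `|e|.
  by rewrite addr_ge0.
by rewrite mulrA c1; ring.
Qed.

Lemma inner_eq0 f : H2 f -> ip f f = 0 -> f = fun=> 0.
Proof.
move=> Hf f0; apply/funext => k; apply/eqP; rewrite -normr_eq0 -sqrf_eq0 eq_le.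
by rewrite -{1}f0 inner_norm_ge // exprn_ge0.
Qed.

(** The Szego kernel 1 / (1 - z^* w) as a function of w; it reproduces the value at z. *)
Definition kernel z : nat -> C := fun n => (z^*) ^+ n.

Lemma H2_kernel z : unit_disk z -> H2 (kernel z).
Proof.
move=> z1; have z2 : 0 < 1 - `|z| ^+ 2 by rewrite subr_gt0 exprn_ilt1 ?normr_ge0.
apply/H2P; exists (1 - `|z| ^+ 2)^-1 => n.
have -> : \sum_(i < n) `|(`|kernel z i| ^+ 2)| = \sum_(i < n) (`|z| ^+ 2) ^+ i.
  apply: eq_bigr => i _; rewrite ger0_norm ?exprn_ge0 // /kernel normrX norm_conjC.
  by rewrite -!exprM mulnC.
rewrite -[leRHS]mul1r ler_pdivlMr // geometric_sum gerBl.
by rewrite !exprn_ge0.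
Qed.

Lemma evalE f z : H2_eval f z = ip f (kernel z).
Proof.
have E : (fun n => f n * z ^+ n) = (fun n => f n * (kernel z n)^*).
  by apply/funext => n; rewrite /kernel -rmorphXn /= conjCK.
by rewrite /H2_eval /H2_inner E.
Qed.

Lemma eval_mulz f z : H2 f -> unit_disk z -> H2_eval (mulz f) z = z * H2_eval f z.
Proof.
move=> Hf z1; have Hk := H2_kernel z1; rewrite !evalE (inner_mulz Hf Hk).
have -> : back (kernel z) = fun n => z^* * kernel z n.
  by apply/funext => n; rewrite /back /kernel exprS.
by rewrite (innerZr _ Hk Hf) conjCK.
Qed.

(** If g vanishes on the punctured disk, then |g_0| <= |z| M for small z with M independent of z, so
    g_0 = 0 and g is z times its backward shift. The punctured disk is what allows division by z in
    the induction. *)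
Lemma eval_eq0 f : H2 f -> (forall z, unit_disk z -> H2_eval f z = 0) -> f = fun=> 0.
Proof.
move=> Hf f0; suff head0 g : H2 g -> (forall z, z != 0 -> unit_disk z -> H2_eval g z = 0) ->
    g 0%N = 0.
  have H k : [/\ H2 (iter k back f),
      (forall z, z != 0 -> unit_disk z -> H2_eval (iter k back f) z = 0) & iter k back f 0%N = 0].
    elim: k => [|k [Hk evk hk]]; first by split=> //; [move=> z _; exact: f0|apply: head0 => // z _; exact: f0].
    have Hb : H2 (iter k.+1 back f) by exact: H2_back.
    have ev z : z != 0 -> unit_disk z -> H2_eval (iter k.+1 back f) z = 0.
      move=> z0 z1; apply: (mulfI z0); rewrite mulr0 -eval_mulz //.
      rewrite -[RHS](evk z z0 z1); congr (H2_eval _ z); apply/funext => -[|//].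
      exact: esym hk.
    by split=> //; exact: head0.
  apply/funext => k; have [_ _] := H k; rewrite -[RHS]/(0 : C) => <-.
  suff -> : forall n, iter k back f n = f (n + k)%N by [].
  by elim: k => [|k IH] n; rewrite ?addn0 //= /back IH addSnnS.
move=> Hg g0; have Hb := H2_back Hg.
apply/eqP; rewrite -normr_eq0; apply: contrapT => /negP gn0.
have [M ME] : exists M, M = ip (back g) (back g) + 2 by eexists.
have M0 : 0 < M by rewrite ME ltr_wpDl ?inner_ge0.
have [x xE] : exists x : C, x = `|g 0%N| by eexists.
have x0 : 0 < x by rewrite xE lt_def gn0 normr_ge0.
(* This gives z M < x, and z <= 1/2, whence the kernel at z has square norm at most 2; this 2 is the
   one in [M]. *)
pose z := x / (2 * (M + x)).
have z0 : 0 < z by rewrite divr_gt0 // mulr_gt0 // addr_gt0.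
have z2 : z <= 2^-1.
  rewrite ler_pdivrMr ?mulr_gt0 ?addr_gt0 // (_ : 2^-1 * _ = M + x); last by field.
  by rewrite lerDr ltW.
have zn : `|z| = z by rewrite ger0_norm ?ltW.
have z1 : unit_disk z.
  by rewrite /unit_disk /= zn (le_lt_trans z2) // invf_lt1 // ltr1n.
have Hk := H2_kernel z1.
have bk : back (kernel z) = fun n => z^* * kernel z n.
  by apply/funext => n; rewrite /back /kernel exprS.
have k0 : kernel z 0%N = 1 by [].
have kk : ip (kernel z) (kernel z) <= 2.
  have := inner_back Hk Hk; rewrite bk (innerZl _ Hk (H2Z (a := z^*) Hk)) (innerZr _ Hk Hk) conjCK k0 rmorph1 mulr1.
  set K := ip _ _ => KE; have K0 : 0 <= K by exact: inner_ge0.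
  have zz : z^* * z <= 2^-1.
    rewrite (geC0_conj (ltW z0)); apply: (le_trans _ z2).
    by rewrite ler_piMl ?(ltW z0) // (le_trans z2) // invf_le1 // ler1n.
  have : K <= 1 + 2^-1 * K.
    by rewrite {1}KE lerD2l mulrA ler_wpM2r.
  rewrite -subr_ge0 => h; rewrite -subr_ge0.
  have -> : 2 - K = 2 * (1 + 2^-1 * K - K) by field.
  by rewrite mulr_ge0.
have := g0 z (lt0r_neq0 z0) z1; rewrite evalE (inner_back Hg Hk) bk (innerZr _ Hk Hb) conjCK.
rewrite k0 rmorph1 mulr1 => /eqP; rewrite addr_eq0 => /eqP gE.
have : x <= z * M.
  rewrite xE gE normrN normrM zn ler_wpM2l ?(ltW z0) //.
  by apply: le_trans (inner_norm_le Hb Hk) _; rewrite ME lerD2l.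
have zM : z * M < x.
  rewrite /z mulrAC ltr_pdivrMr ?mulr_gt0 ?addr_gt0 // ltr_pM2l //.
  by rewrite mulrDr -[ltLHS]addr0 -[M in ltLHS]mul1r ltrD ?mulr_gt0 // ltr_pM2r // ltr1n.
by move=> /le_lt_trans/(_ zM); rewrite ltxx.
Qed.

End HardySpace.

(** * Blaschke products acting on coefficients; the model space and its compressed shift *)

Section ModelSpace.
Context {R : realType}.
Local Notation C := (R[i]).
Local Notation ip := (@H2_inner R).
Implicit Types (f g h u v : nat -> C) (a b z : C) (p q : {poly C}) (s : seq C).

Local Opaque H2.

(** On Taylor coefficients: multiplication by 1 - a z and by z - a, the adjoint of the latter, and
    division by 1 - a z. *)
Definition mul_sub1 a f : nat -> C := fun n => f n - a * mulz f n.
Definition mul_Xsub a f : nat -> C := fun n => mulz f n - a * f n.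
Definition adj_Xsub a f : nat -> C := fun n => back f n - a^* * f n.
Fixpoint div_sub1 a f n : C :=
  if n is k.+1 then f n + a * div_sub1 a f k else f 0%N.

Lemma div_sub1K a f : mul_sub1 a (div_sub1 a f) = f.
Proof. by apply/funext => -[|n]; rewrite /mul_sub1 /= ?mulr0 ?subr0 ?addrK. Qed.

Lemma mul_sub1K a f : div_sub1 a (mul_sub1 a f) = f.
Proof.
apply/funext; elim=> [|n IH] /=; first by rewrite /mul_sub1 mulr0 subr0.
by rewrite IH /mul_sub1 /= subrK.
Qed.

Lemma mul_XsubC a b f : mul_Xsub b (mul_sub1 a f) = mul_sub1 a (mul_Xsub b f).
Proof. by apply/funext => -[|[|n]]; rewrite /mul_Xsub /mul_sub1 /=; ring. Qed.

Lemma mul_Xsub_div a b f : mul_Xsub b (div_sub1 a f) = div_sub1 a (mul_Xsub b f).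
Proof. by rewrite -[LHS](mul_sub1K a) -mul_XsubC div_sub1K. Qed.

(** The adjoint of multiplication by z - a is the backward shift after multiplication by 1 - a^* z.
    This is why K_Theta consists of quotients with polynomial numerators. *)
Lemma adj_Xsub_div a f : adj_Xsub a (div_sub1 a^* f) = back f.
Proof. by apply/funext => n; rewrite /adj_Xsub /back /= addrK. Qed.

Lemma H2_mul_sub1 a f : H2 f -> H2 (mul_sub1 a f).
Proof. by move=> Hf; exact: H2B Hf (H2Z (a := a) (H2_mulz Hf)). Qed.

Lemma H2_mul_Xsub a f : H2 f -> H2 (mul_Xsub a f).
Proof. by move=> Hf; exact: H2B (H2_mulz Hf) (H2Z (a := a) Hf). Qed.

Lemma H2_adj_Xsub a f : H2 f -> H2 (adj_Xsub a f).
Proof. by move=> Hf; exact: H2B (H2_back Hf) (H2Z (a := a^*) Hf). Qed.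

(* Convexity of the square: x + k y = (1 - k) (x / (1 - k)) + k y. *)
Lemma sqr_convex (k x y : C) : 0 <= k -> k < 1 -> 0 <= x -> 0 <= y ->
  (x + k * y) ^+ 2 <= (1 - k)^-1 * x ^+ 2 + k * y ^+ 2.
Proof.
move=> k0 k1 x0 y0; have d0 : 0 < 1 - k by rewrite subr_gt0.
rewrite -subr_ge0.
have -> : (1 - k)^-1 * x ^+ 2 + k * y ^+ 2 - (x + k * y) ^+ 2 =
    k / (1 - k) * (x - (1 - k) * y) ^+ 2 by field; rewrite lt0r_neq0.
by rewrite mulr_ge0 ?divr_ge0 ?(ltW d0) // sqr_sub_ge0 // mulr_ge0 // ltW.
Qed.

(** Division by 1 - a z has operator norm at most 1 / (1 - k) with k = |a|. Applying [sqr_convex] to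
    the recursion closes the induction, as (1 - k)^-1 + k (1 - k)^-2 = (1 - k)^-2. *)
Lemma H2_div_sub1 a f : `|a| < 1 -> H2 f -> H2 (div_sub1 a f).
Proof.
move=> a1 /H2P[M fM]; apply/H2P; set k := `|a| in a1.
have k0 : 0 <= k by exact: normr_ge0.
have d0 : 0 < 1 - k by rewrite subr_gt0.
have dv0 : 0 <= (1 - k)^-1 by rewrite invr_ge0 ltW.
suff H n : \sum_(i < n) `|(`|div_sub1 a f i| ^+ 2)| <=
    (1 - k) ^- 2 * \sum_(i < n) `|(`|f i| ^+ 2)|.
  exists ((1 - k) ^- 2 * M) => n; apply: le_trans (H n) _.
  by rewrite ler_wpM2l // -exprVn exprn_ge0.
elim: n => [|n IH]; first by rewrite !big_ord0 mulr0.
have step (i : 'I_n) : `|(`|div_sub1 a f i.+1| ^+ 2)| <=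
    (1 - k)^-1 * `|(`|f i.+1| ^+ 2)| + k * `|(`|div_sub1 a f i| ^+ 2)|.
  rewrite !(ger0_norm (exprn_ge0 _ (normr_ge0 _))) /=.
  apply: le_trans (sqr_convex k0 a1 (normr_ge0 _) (normr_ge0 _)).
  rewrite ler_pXn2r ?nnegrE ?addr_ge0 ?mulr_ge0 //.
  by rewrite /k -normrM ler_normD.
rewrite big_ord_recl /=; apply: le_trans (lerD (lexx _) (ler_sum _ (fun i _ => step i))) _.
rewrite big_split -!mulr_sumr /=.
have S : \sum_(i < n.+1) `|(`|f i| ^+ 2)| = `|(`|f 0%N| ^+ 2)| + \sum_(i < n) `|(`|f i.+1| ^+ 2)|.
  by rewrite big_ord_recl.
have S' : \sum_(i < n) `|(`|f i| ^+ 2)| <= \sum_(i < n.+1) `|(`|f i| ^+ 2)|.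
  by rewrite big_ord_recr /= lerDl.
set F := \sum_(i < n.+1) _ in S S' *; set G := \sum_(i < n) `|(`|f _.+1| ^+ 2)| in S *.
apply: (@le_trans _ _ ((1 - k)^-1 * F + k * ((1 - k) ^- 2 * F))).
  rewrite addrA; apply: lerD; last first.
    by rewrite ler_wpM2l //; apply: le_trans IH _; rewrite ler_wpM2l // -exprVn exprn_ge0.
  rewrite S mulrDr lerD2r -[leLHS]mul1r ler_wpM2r // invf_ge1 //.
  by rewrite gerBl.
rewrite le_eqVlt; apply/orP; left; apply/eqP; field.
by rewrite lt0r_neq0.
Qed.

Lemma inner_mul_Xsub a f g : H2 f -> H2 g -> ip (mul_Xsub a f) g = ip f (adj_Xsub a g).
Proof.
move=> Hf Hg; rewrite (innerBl (H2_mulz Hf) (H2Z (a := a) Hf) Hg).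
rewrite (innerBr (H2_back Hg) (H2Z (a := a^*) Hg) Hf).
by rewrite (inner_mulz Hf Hg) (innerZl a Hf Hg) (innerZr _ Hg Hf) conjCK.
Qed.

Lemma evalB f g z : H2 f -> H2 g -> unit_disk z ->
  H2_eval (fun n => f n - g n) z = H2_eval f z - H2_eval g z.
Proof. by move=> Hf Hg /H2_kernel Hk; rewrite !evalE (innerBl Hf Hg Hk). Qed.

Lemma evalZ a f z : H2 f -> unit_disk z ->
  H2_eval (fun n => a * f n) z = a * H2_eval f z.
Proof. by move=> Hf /H2_kernel Hk; rewrite !evalE (innerZl a Hf Hk). Qed.

Lemma eval_mul_sub1 a f z : H2 f -> unit_disk z ->
  H2_eval (mul_sub1 a f) z = (1 - a * z) * H2_eval f z.
Proof.
move=> Hf z1; rewrite (evalB Hf (H2Z (a := a) (H2_mulz Hf)) z1).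
by rewrite (evalZ a (H2_mulz Hf) z1) (eval_mulz Hf z1); ring.
Qed.

Lemma eval_mul_Xsub a f z : H2 f -> unit_disk z ->
  H2_eval (mul_Xsub a f) z = (z - a) * H2_eval f z.
Proof.
move=> Hf z1; rewrite (evalB (H2_mulz Hf) (H2Z (a := a) Hf) z1).
by rewrite (evalZ a Hf z1) (eval_mulz Hf z1); ring.
Qed.

(** The left folds invert or dualize the right folds: they treat the outermost factor first, so
    cancellations and adjoints follow the list. *)
Definition mul_numer s f := foldr mul_Xsub f s.
Definition div_denom s f := foldr (fun a => div_sub1 a^*) f s.
Definition mul_denom s f := foldl (fun h a => mul_sub1 a^* h) f s.
Definition adj_numer s f := foldl (fun h a => adj_Xsub a h) f s.
Definition in_disk s := forall a, a \in s -> unit_disk a.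

Lemma in_disk_cons a s : in_disk (a :: s) -> unit_disk a /\ in_disk s.
Proof.
by move=> H; split=> [|b bs]; apply: H; rewrite in_cons ?eqxx ?bs ?orbT.
Qed.

Lemma div_denomK s f : mul_denom s (div_denom s f) = f.
Proof. by elim: s f => //= a s IH f; rewrite div_sub1K. Qed.

Lemma mul_denomK s f : div_denom s (mul_denom s f) = f.
Proof. by elim: s f => //= a s IH f; rewrite IH mul_sub1K. Qed.

Lemma mul_numer_div s t f : mul_numer t (div_denom s f) = div_denom s (mul_numer t f).
Proof.
have comm a g : mul_numer t (div_sub1 a g) = div_sub1 a (mul_numer t g).
  by elim: t => //= b t ->; rewrite mul_Xsub_div.
by elim: s => //= a s IH; rewrite comm IH.
Qed.

Lemma adj_numer_back s f : adj_numer s (back f) = back (adj_numer s f).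
Proof. by elim: s f => //= a s IH f; rewrite -IH. Qed.

Lemma adj_numer_div s f : adj_numer s (div_denom s f) = iter (size s) back f.
Proof. by elim: s => //= a s IH; rewrite adj_Xsub_div adj_numer_back IH. Qed.

Lemma H2_mul_numer s f : H2 f -> H2 (mul_numer s f).
Proof. move=> Hf; elim: s => [|a s IH]; [exact: Hf|exact: H2_mul_Xsub IH]. Qed.

Lemma H2_mul_denom s f : H2 f -> H2 (mul_denom s f).
Proof.
elim: s f => [|a s IH] f Hf; [exact: Hf|exact: IH _ (H2_mul_sub1 Hf)].
Qed.

Lemma H2_adj_numer s f : H2 f -> H2 (adj_numer s f).
Proof.
elim: s f => [|a s IH] f Hf; [exact: Hf|exact: IH _ (H2_adj_Xsub Hf)].
Qed.

Lemma H2_div_denom s f : in_disk s -> H2 f -> H2 (div_denom s f).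
Proof.
elim: s => [|a s IH] s1 Hf; first exact: Hf.
have [a1 {}s1] := in_disk_cons s1.
by apply: H2_div_sub1 (IH s1 Hf); rewrite norm_conjC.
Qed.

Lemma inner_mul_numer s f g : H2 f -> H2 g -> ip (mul_numer s f) g = ip f (adj_numer s g).
Proof.
move=> Hf; elim: s g => [//|a s IH] g Hg.
by rewrite /= (inner_mul_Xsub a (H2_mul_numer (s := s) Hf) Hg) (IH _ (H2_adj_Xsub (a := a) Hg)).
Qed.

Lemma eval_mul_numer s f z : H2 f -> unit_disk z ->
  H2_eval (mul_numer s f) z = \prod_(a <- s) (z - a) * H2_eval f z.
Proof.
move=> Hf z1; elim: s => [|a s IH] /=; first by rewrite big_nil mul1r.
by rewrite (eval_mul_Xsub a (H2_mul_numer (s := s) Hf) z1) IH big_cons mulrA.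
Qed.

Lemma eval_mul_denom s f z : H2 f -> unit_disk z ->
  H2_eval (mul_denom s f) z = \prod_(a <- s) (1 - a^* * z) * H2_eval f z.
Proof.
move=> Hf z1; elim: s f Hf => [|a s IH] f Hf /=; first by rewrite big_nil mul1r.
by rewrite (IH _ (H2_mul_sub1 (a := a^*) Hf)) (eval_mul_sub1 _ Hf z1) big_cons; ring.
Qed.

Definition coefs p : nat -> C := fun k => p`_k.

Lemma H2_coefs p : H2 (coefs p).
Proof. by apply: (@H2_finite _ _ (size p)) => k; exact: nth_default. Qed.

Lemma coefs_mulX p : coefs ('X * p) = mulz (coefs p).
Proof. by apply/funext => -[|n]; rewrite /coefs coefXM. Qed.

Lemma coefsD p q : coefs (p + q) = fun n => coefs p n + coefs q n.
Proof. by apply/funext => n; rewrite /coefs coefD. Qed.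

Lemma coefsZ a p : coefs (a *: p) = fun n => a * coefs p n.
Proof. by apply/funext => n; rewrite /coefs coefZ. Qed.

Lemma coefs_prod_Xsub s : coefs (\prod_(a <- s) ('X - a%:P)) = mul_numer s (coefs 1).
Proof.
elim: s => [|a s IH] /=; first by rewrite big_nil.
rewrite big_cons mulrBl mul_polyC -IH; apply/funext => n.
by rewrite /coefs /mul_Xsub coefB coefZ -[mulz _]coefs_mulX.
Qed.

Lemma coefs_eq0 p : coefs p = (fun=> 0) -> p = 0.
Proof. by move=> p0; apply/polyP => n; rewrite coef0 -[LHS]/(coefs p n) p0. Qed.

Lemma div_denomD s f g :
  div_denom s (fun n => f n + g n) = fun n => div_denom s f n + div_denom s g n.
Proof.
elim: s => //= a s ->; apply/funext; elim=> [//|n IH] /=.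
by rewrite IH; ring.
Qed.

Lemma div_denomZ s a f : div_denom s (fun n => a * f n) = fun n => a * div_denom s f n.
Proof.
elim: s => //= b s ->; apply/funext; elim=> [//|n IH] /=.
by rewrite IH; ring.
Qed.

Lemma div_denom_mulz s f : div_denom s (mulz f) = mulz (div_denom s f).
Proof.
elim: s => //= a s ->; apply/funext; elim=> [//|n IH] /=; rewrite IH.
by case: n {IH} => [|n] //=; rewrite mulr0 addr0.
Qed.

(* The sequence of Taylor coefficients of [p / \prod_(a <- s) (1 - a^* z)]. *)
Definition rat_seq s p := div_denom s (coefs p).
Definition rat_form s p q := ip (rat_seq s p) (rat_seq s q).

Lemma H2_rat_seq s p : in_disk s -> H2 (rat_seq s p).
Proof.
by move=> s1; exact: H2_div_denom s1 (H2_coefs (p := p)).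
Qed.

Lemma rat_formDl s p q (r : {poly C}) : in_disk s ->
  rat_form s (p + q) r = rat_form s p r + rat_form s q r.
Proof.
move=> s1; rewrite /rat_form {1}/rat_seq coefsD div_denomD.
exact: innerDl (H2_rat_seq (p := p) s1) (H2_rat_seq (p := q) s1) (H2_rat_seq (p := r) s1).
Qed.

Lemma rat_formZl s a p (r : {poly C}) : in_disk s -> rat_form s (a *: p) r = a * rat_form s p r.
Proof.
move=> s1; rewrite /rat_form {1}/rat_seq coefsZ div_denomZ.
exact: innerZl (H2_rat_seq (p := p) s1) (H2_rat_seq (p := r) s1).
Qed.

Lemma rat_formC s p q : in_disk s -> rat_form s q p = (rat_form s p q)^*.
Proof. by move=> s1; exact: innerC (H2_rat_seq (p := p) s1) (H2_rat_seq (p := q) s1). Qed.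

Lemma rat_form_gt0 s p : in_disk s -> p != 0 -> 0 < rat_form s p p.
Proof.
move=> s1 p0; have Hp := H2_rat_seq (p := p) s1; rewrite lt_def (inner_ge0 Hp) andbT.
apply: contra_neq p0 => /(inner_eq0 Hp) E; apply: coefs_eq0.
rewrite -(div_denomK s (coefs p)) -/(rat_seq s p) E.
elim: s {s1 Hp E} => //= a s IH; rewrite (_ : mul_sub1 _ _ = fun=> 0) //.
by apply/funext => -[|n]; rewrite /mul_sub1 /= mulr0 subr0.
Qed.

Lemma rat_formX s p q : in_disk s -> rat_form s ('X * p) ('X * q) = rat_form s p q.
Proof.
move=> s1; rewrite /rat_form /rat_seq !coefs_mulX !div_denom_mulz.
have [Hp Hq] := (H2_rat_seq (p := p) s1, H2_rat_seq (p := q) s1).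
by rewrite (inner_mulz Hp (H2_mulz Hq)).
Qed.

Lemma iter_back k f n : iter k back f n = f (n + k)%N.
Proof. by elim: k n => [|k IH] n; rewrite ?addn0 //= /back IH addSnnS. Qed.

Lemma adj_numer_rat_seq s p : (size p <= size s)%N -> adj_numer s (rat_seq s p) = fun=> 0.
Proof.
move=> ps; rewrite adj_numer_div; apply/funext => n.
by rewrite iter_back /coefs nth_default // (leq_trans ps) ?leq_addl.
Qed.

Lemma inner_numer_rat_seq s u p : in_disk s -> H2 u -> (size p <= size s)%N ->
  ip (mul_numer s u) (rat_seq s p) = 0.
Proof.
move=> s1 Hu ps; rewrite (inner_mul_numer s Hu (H2_rat_seq (p := p) s1)) adj_numer_rat_seq //.
have H0 := @H2_finite R (fun=> 0) 0 (fun _ _ => erefl).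
by rewrite (innerC H0 Hu) inner0l rmorph0.
Qed.

Lemma rat_form_prod_Xsub s (r : {poly C}) : in_disk s -> (size r <= size s)%N ->
  rat_form s (\prod_(a <- s) ('X - a%:P)) r = 0.
Proof.
move=> s1 rs; rewrite /rat_form {1}/rat_seq coefs_prod_Xsub -mul_numer_div.
exact: inner_numer_rat_seq s1 (H2_rat_seq (p := 1) s1) rs.
Qed.

Section Blaschke.
Variable Theta : finite_blaschke R.
Local Notation s := (blaschke_zeros Theta).

Lemma blaschke_in_disk : in_disk s.
Proof. exact: blaschke_zerosP. Qed.

Lemma blaschke_evalE z : unit_disk z ->
  Theta z * \prod_(a <- s) (1 - a^* * z) = blaschke_const Theta * \prod_(a <- s) (z - a).
Proof.
move=> z1; rewrite /blaschke_eval -mulrA -big_split; congr (_ * _).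
rewrite !big_seq; apply: eq_bigr => a /blaschke_in_disk a1 /=.
by rewrite divfK // sub1M_neq0 ?norm_conjC // ltW.
Qed.

(** The constant and the denominators of Theta act invertibly on H^2, so only its numerator matters;
    [eval_eq0] turns equal functions into equal coefficients. *)
Lemma theta_H2P g : theta_H2 Theta g <-> exists2 u, H2 u & g = mul_numer s u.
Proof.
have l0 : blaschke_const Theta != 0.
  by rewrite -normr_gt0 blaschke_constP.
split=> [[Hg [h Hh gh]]|[u Hu ->]].
  have Hlh := H2Z (a := blaschke_const Theta) Hh.
  exists (div_denom s (fun n => blaschke_const Theta * h n)).
    exact: H2_div_denom blaschke_in_disk Hlh.
  rewrite mul_numer_div -[LHS](mul_denomK s); congr (div_denom _ _).
  have H1 := H2_mul_denom (s := s) Hg; have H2 := H2_mul_numer (s := s) Hlh.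
  have := @eval_eq0 _ _ (H2B H1 H2).
  suff ev z : unit_disk z ->
      H2_eval (fun n => mul_denom s g n - mul_numer s (fun n => blaschke_const Theta * h n) n) z = 0.
    move=> /(_ ev) /funeqP E; apply/funext => n; apply/eqP; rewrite -subr_eq0; apply/eqP.
    exact: E.
  move=> z1; rewrite (evalB H1 H2 z1) (eval_mul_denom s Hg z1) (eval_mul_numer s Hlh z1).
  rewrite (evalZ _ Hh z1) (gh z z1).
  have cross (x y c e t : C) : t * x = c * y -> x * (t * e) - y * (c * e) = 0.
    by move=> E; rewrite mulrA (mulrC x) E; ring.
  exact: cross (blaschke_evalE z1).
split; first exact: H2_mul_numer.
exists (fun n => (blaschke_const Theta)^-1 * mul_denom s u n).
  exact: H2Z (H2_mul_denom (s := s) Hu).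
move=> z z1; rewrite (evalZ _ (H2_mul_denom (s := s) Hu) z1) (eval_mul_denom s Hu z1).
rewrite (eval_mul_numer s Hu z1).
have cross (x y c e t : C) : c != 0 -> t * x = c * y -> y * e = t * (c^-1 * (x * e)).
  by move=> c0 E; rewrite mulrCA (mulrA t) E; field.
exact: cross l0 (blaschke_evalE z1).
Qed.

Lemma model_spaceP f : model_space Theta f <->
  exists2 p : {poly C}, (size p <= size s)%N & f = rat_seq s p.
Proof.
split=> [[Hf fg]|[p ps ->]]; last first.
  have Hp := H2_rat_seq (p := p) blaschke_in_disk; split=> // g /theta_H2P[u Hu ->].
  rewrite (innerC (H2_mul_numer (s := s) Hu) Hp) inner_numer_rat_seq ?rmorph0 //.
  exact: blaschke_in_disk.
have Ha := H2_adj_numer (s := s) Hf.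
have A0 : adj_numer s f = fun=> 0.
  apply: (inner_eq0 Ha); rewrite -(inner_mul_numer s Ha Hf) (innerC Hf (H2_mul_numer (s := s) Ha)).
  (* Testing f against the numerator times [adj_numer s f] yields the square norm of
     [adj_numer s f]. *)
  have Tg : theta_H2 Theta (mul_numer s (adj_numer s f)).
    by apply/theta_H2P; exists (adj_numer s f); [exact: Ha|].
  by rewrite (fg _ Tg) rmorph0.
pose r := mul_denom s f.
have fr : f = div_denom s r by rewrite mul_denomK.
(* By [adj_numer_div], [adj_numer s f] is the (size s)-fold backward shift of [r]; as it vanishes,
   [r] is a polynomial. *)
have r0 k : (size s <= k)%N -> r k = 0.
  move=> sk; rewrite -(subnK sk) -iter_back -adj_numer_div -fr A0.
  by [].
exists (\poly_(i < size s) r i); first exact: size_poly.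
rewrite fr /rat_seq; congr (div_denom _ _); apply/funext => k.
rewrite /coefs coef_poly; case: ltnP => // /r0 //.
Qed.

Lemma compressed_shift_inner p n : size s = n.+1 -> (size p <= n.+1)%N ->
  ip (compressed_shift Theta (rat_seq s p)) (rat_seq s p) = rat_form s ('X * p) p.
Proof.
move=> sn pn; have s1 := blaschke_in_disk.
have Kp : model_space Theta (rat_seq s p) by apply/model_spaceP; exists p; rewrite ?sn.
pose N : {poly C} := \prod_(a <- s) ('X - a%:P).
pose q := 'X * p - p`_n *: N.
have qs : (size q <= n.+1)%N.
  apply/leq_sizeP => j; rewrite leq_eqVlt => /orP[/eqP <-|nj].
    rewrite coefB coefXM /= coefZ; have : N \is monic by exact: monic_prod_XsubC.
    by move=> /monicP; rewrite lead_coefE size_prod_XsubC sn /= => ->; rewrite mulr1 subrr.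
  rewrite coefB coefZ [N`_j]nth_default ?size_prod_XsubC ?sn // mulr0 subr0 coefXM.
  by case: j nj => //= j nj; rewrite nth_default // (leq_trans pn).
have Hz := H2_mulz (H2_rat_seq (p := p) s1).
have zE : rat_seq s ('X * p) = mulz (rat_seq s p).
  by rewrite /rat_seq coefs_mulX div_denom_mulz.
set P := [set h | model_space Theta h /\
  forall k, model_space Theta k -> ip (fun n => mulz (rat_seq s p) n - h n) k = 0].
have : P (compressed_shift Theta (rat_seq s p)).
  apply: xgetPex; exists (rat_seq s q); split; first by apply/model_spaceP; exists q; rewrite ?sn.
  move=> _ /model_spaceP[r rn ->].
  have -> : (fun n => mulz (rat_seq s p) n - rat_seq s q n) = rat_seq s (p`_n *: N).
    rewrite -zE; apply/funext => k; apply/eqP; rewrite subr_eq; apply/eqP.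
    have -> : 'X * p = p`_n *: N + q by rewrite addrC subrK.
    by rewrite /rat_seq coefsD div_denomD.
  rewrite -[ip _ _]/(rat_form s (p`_n *: N) r) rat_formZl // rat_form_prod_Xsub //.
  by rewrite mulr0.
(* Whichever projection [xget] selects, its difference from z p is orthogonal to p itself, and this
   determines the inner product. *)
move=> [[Hc _] /(_ _ Kp)]; have Hp := H2_rat_seq (p := p) s1.
rewrite (innerBl Hz Hc Hp) => /eqP; rewrite subr_eq0 => /eqP <-.
by rewrite /rat_form zE.
Qed.

End Blaschke.
End ModelSpace.

(** * Attainment of the maximum by compactness *)

Section MaximumOfMoebius.
Context {R : realType} {n : nat}.
Local Notation C := (R[i]).
Local Notation V := 'rV[C]_n.+1.
Local Notation X := 'rV[R]_(n.+1 + n.+1).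

(** Real coordinates of complex rows, so that the extreme value theorem applies on a sphere in a
    real space. *)
Definition complex_row (x : X) : V :=
  \row_j (x 0 (lshift n.+1 j) +i* x 0 (rshift n.+1 j))%C.

Lemma complex_row_surj (v : V) : exists x, complex_row x = v.
Proof.
exists (row_mx (\row_j complex.Re (v 0 j)) (\row_j complex.Im (v 0 j))).
by apply/rowP => j; rewrite mxE row_mxEl row_mxEr !mxE; case: (v 0 j).
Qed.

Lemma complex_rowZ (t : R) x : complex_row (t *: x) = ((t%:C)%C) *: complex_row x.
Proof.
apply/rowP => j; rewrite !mxE; apply/eqP; rewrite eq_complex /=.
by rewrite !mul0r subr0 addr0 !eqxx.
Qed.

Lemma complex_row_eq0 x : complex_row x = 0 -> x = 0.
Proof.
move=> /rowP E; apply/rowP => j; rewrite [RHS]mxE.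
have H k : x 0 (lshift n.+1 k) = 0 /\ x 0 (rshift n.+1 k) = 0.
  by have := E k; rewrite !mxE => -[].
by case: (splitP j) => k jk; have [l r] := H k; [rewrite -[RHS]l|rewrite -[RHS]r];
  congr (x 0 _); apply/val_inj.
Qed.

Definition ccontinuous (F : X -> C) :=
  continuous (fun x => complex.Re (F x) : R) /\ continuous (fun x => complex.Im (F x) : R).

Lemma ccontinuous_cst (c : C) : ccontinuous (fun=> c).
Proof. by split=> x; exact: cst_continuous. Qed.

Lemma ccontinuousD F G : ccontinuous F -> ccontinuous G -> ccontinuous (fun x => F x + G x).
Proof.
move=> [Fr Fi] [Gr Gi]; split=> x.
  rewrite (_ : (fun x => _) = (fun x => complex.Re (F x) + complex.Re (G x))).
    exact: (cvgD (Fr x) (Gr x)).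
  by apply/funext => y; case: (F y); case: (G y).
rewrite (_ : (fun x => _) = (fun x => complex.Im (F x) + complex.Im (G x))).
  exact: (cvgD (Fi x) (Gi x)).
by apply/funext => y; case: (F y); case: (G y).
Qed.

Lemma ccontinuousM F G : ccontinuous F -> ccontinuous G -> ccontinuous (fun x => F x * G x).
Proof.
move=> [Fr Fi] [Gr Gi]; split=> x.
  rewrite (_ : (fun x => _) = (fun x => complex.Re (F x) * complex.Re (G x) -
      complex.Im (F x) * complex.Im (G x))).
    exact: (cvgB (cvgM (Fr x) (Gr x)) (cvgM (Fi x) (Gi x))).
  by apply/funext => y; case: (F y); case: (G y).
rewrite (_ : (fun x => _) = (fun x => complex.Re (F x) * complex.Im (G x) +
    complex.Im (F x) * complex.Re (G x))).
  exact: (cvgD (cvgM (Fr x) (Gi x)) (cvgM (Fi x) (Gr x))).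
by apply/funext => y; case: (F y); case: (G y).
Qed.

Lemma ccontinuous_conj F : ccontinuous F -> ccontinuous (fun x => (F x)^*).
Proof.
move=> [Fr Fi]; split=> x.
  rewrite (_ : (fun x => _) = (fun x => complex.Re (F x))); first exact: Fr.
  by apply/funext => y; case: (F y).
rewrite (_ : (fun x => _) = (fun x => - complex.Im (F x))).
  exact: (cvgN (Fi x)).
by apply/funext => y; case: (F y).
Qed.

Lemma ccontinuous_sum I (r : seq I) (F : I -> X -> C) :
  (forall i, ccontinuous (F i)) -> ccontinuous (fun x => \sum_(i <- r) F i x).
Proof.
move=> Fc; elim: r => [|i r IH].
  rewrite (_ : (fun x => _) = fun=> 0); first exact: ccontinuous_cst.
  by apply/funext => x; rewrite big_nil.
rewrite (_ : (fun x => _) = fun x => F i x + \sum_(j <- r) F j x).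
  exact: ccontinuousD.
by apply/funext => x; rewrite big_cons.
Qed.

Lemma ccontinuous_coord j : ccontinuous (fun x => complex_row x 0 j).
Proof.
split=> x.
  rewrite (_ : (fun x => _) = (fun x : X => x 0 (lshift n.+1 j))); first exact: coord_continuous.
  by apply/funext => y; rewrite mxE.
rewrite (_ : (fun x => _) = (fun x : X => x 0 (rshift n.+1 j))); first exact: coord_continuous.
by apply/funext => y; rewrite mxE.
Qed.

Context (dot : V -> V -> C).
Hypothesis dotDl : forall u v w, dot (u + v) w = dot u w + dot v w.
Hypothesis dotZl : forall a u w, dot (a *: u) w = a * dot u w.
Hypothesis dotC : forall u v, dot v u = (dot u v)^*.
Hypothesis dot_gt0 : forall v, v != 0 -> 0 < dot v v.

Lemma ccontinuous_form (A : 'M[C]_n.+1) :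
  ccontinuous (fun x => dot (complex_row x *m A) (complex_row x)).
Proof.
pose e i : V := delta_mx 0 i.
rewrite (_ : (fun x => _) = (fun x => \sum_i \sum_j
   complex_row x 0 i * ((complex_row x 0 j)^* * dot (e i *m A) (e j)))).
  apply: ccontinuous_sum => i; apply: ccontinuous_sum => j.
  apply: ccontinuousM; first exact: ccontinuous_coord.
  apply: ccontinuousM; last exact: ccontinuous_cst.
  by apply: ccontinuous_conj; exact: ccontinuous_coord.
apply/funext => x; move: (complex_row x) => v.
rewrite {1}[v]row_sum_delta mulmx_suml (dot_suml dotDl dotZl); apply: eq_bigr => i _.
rewrite -scalemxAl dotZl -mulr_sumr; congr (_ * _).
rewrite dotC {1}[v]row_sum_delta (dot_suml dotDl dotZl) rmorph_sum.
by apply: eq_bigr => j _; rewrite dotZl rmorphM /= -dotC.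
Qed.

Definition normsq (z : C) : R := complex.Re z ^+ 2 + complex.Im z ^+ 2.

Lemma normsqE z : ((normsq z)%:C)%C = `|z| ^+ 2.
Proof. exact: add_Re2_Im2. Qed.

Lemma continuous_normsq F : ccontinuous F -> continuous (fun x => normsq (F x)).
Proof.
move=> [Fr Fi] x.
exact: (cvgD (cvgM (Fr x) (Fr x)) (cvgM (Fi x) (Fi x))).
Qed.

(** [b] is invariant under scaling, so it suffices to maximize over the unit sphere [S] of the norm
    of the real coordinates, which is compact. There b^2 is a quotient of continuous functions. *)
Lemma form_moebius_max (A : 'M[C]_n.+1) z0 : `|z0| < 1 ->
  (forall v, v != 0 -> `|dot (v *m A) v| < dot v v) ->
  let b v := `|dot (v *m A) v / dot v v - z0| / `|1 - z0^* * (dot (v *m A) v / dot v v)| in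
  exists2 v, v != 0 & forall w, w != 0 -> b w <= b v.
Proof.
move=> z1 wA b.
pose F x := dot (complex_row x *m A) (complex_row x).
pose Q x := dot (complex_row x) (complex_row x).
have Fc : ccontinuous F by exact: ccontinuous_form.
have Qc : ccontinuous Q.
  rewrite (_ : Q = fun x => dot (complex_row x *m 1%:M) (complex_row x)).
    exact: ccontinuous_form.
  by apply/funext => x; rewrite mulmx1.
(* Numerator and denominator of [b], both multiplied by [Q x]; the denominator is nonzero because
   |F| < Q and |z0| < 1. *)
pose num x := F x + - z0 * Q x.
pose den x := Q x + - z0^* * F x.
have numc : continuous (fun x => normsq (num x)).
  by apply: continuous_normsq; apply: ccontinuousD => //; apply: ccontinuousM => //; exact: ccontinuous_cst.
have denc : continuous (fun x => normsq (den x)).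
  by apply: continuous_normsq; apply: ccontinuousD => //; apply: ccontinuousM => //; exact: ccontinuous_cst.
have row0 x : x != 0 -> complex_row x != 0.
  by apply: contra_neq; exact: complex_row_eq0.
have den0 x : x != 0 -> normsq (den x) != 0.
  move=> /row0 x0; have := wA _ x0; have q0 := dot_gt0 x0; rewrite -/(F x) -/(Q x) in q0 * => FQ.
  apply/eqP => E; have : `|den x| ^+ 2 = 0 by rewrite -normsqE E.
  move=> /eqP; rewrite sqrf_eq0 normr_eq0 /den mulNr subr_eq0 => /eqP E2.
  have : `|Q x| < Q x.
    rewrite {1}E2 normrM norm_conjC; apply: le_lt_trans FQ.
    by rewrite ler_piMl ?normr_ge0 // ltW.
  by rewrite ger0_norm ?ltxx // ltW.
pose H x : R := normsq (num x) / normsq (den x).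
have bE x : x != 0 -> ((H x)%:C)%C = b (complex_row x) ^+ 2.
  move=> x0; rewrite /H rmorphM fmorphV /= !normsqE /b -/(F x) -/(Q x) -exprVn -exprMn.
  have q0 : 0 < Q x by apply: dot_gt0; exact: row0.
  have q0' := lt0r_neq0 q0.
  have -> : num x = Q x * (F x / Q x - z0) by rewrite /num; field.
  have -> : den x = Q x * (1 - z0^* * (F x / Q x)) by rewrite /den; field.
  by rewrite !normrM invfM mulrACA divff ?normr_eq0 // mul1r.
pose S : set X := [set x | `|x| = 1].
have S0 x : S x -> x != 0 by move=> Sx; rewrite -normr_eq0 Sx oner_eq0.
have norm1 x : x != 0 -> S (`|x|^-1 *: x).
  by move=> x0; rewrite /S /= normrZ normfV normr_id mulVf // normr_eq0.
have Sne : S !=set0.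
  exists (`|const_mx 1 : X|^-1 *: const_mx 1); apply: norm1.
  apply/eqP => /rowP /(_ (lshift n.+1 ord0)); rewrite !mxE.
  by apply/eqP; rewrite oner_eq0.
have Scpt : compact S.
  apply: bounded_closed_compact.
    exists 1; split; first exact: num_real.
    by move=> M M1 x Sx /=; rewrite Sx ltW.
  rewrite (_ : S = (fun x : X => `|x|) @^-1` [set 1]) //.
  apply: closed_comp => [x _|]; first exact: norm_continuous.
  exact: closed_eq.
have Hc : {within S, continuous H}.
  apply: continuous_in_subspaceT => x /set_mem /S0 x0.
  exact: (cvgM (numc x) (cvgV (den0 x x0) (denc x))).
have [x xS xmax] := compact_EVT_max Sne Scpt Hc.
have x0 : x != 0 by apply: S0; exact: set_mem.
exists (complex_row x); first exact: row0.
move=> w w0; have [y yw] := complex_row_surj w.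
have y0 : y != 0.
  apply: contra_neq w0 => y0; rewrite -yw y0; apply/rowP => j; by rewrite !mxE.
have b0 v : 0 <= b v by rewrite divr_ge0.
have -> : b w = b (complex_row (`|y|^-1 *: y)).
  rewrite complex_rowZ yw; set t := (_%:C)%C.
  have t0 : t != 0.
    rewrite /t -[0]/((0%:C)%C : C) eq_complex /= eqxx andbT.
    by rewrite invr_eq0 normr_eq0.
  move: t t0 => t t0.
  rewrite /b -scalemxAl !dotZl !(dotZr dotZl dotC).
  have -> : t * (t^* * dot (w *m A) w) / (t * (t^* * dot w w)) = dot (w *m A) w / dot w w.
    by field; rewrite (lt0r_neq0 (dot_gt0 w0)) t0 andbT fmorph_eq0.
  by [].
have S1 := norm1 y y0.
rewrite -(ler_pXn2r (n := 2)) ?nnegrE // -(bE _ (S0 _ S1)) -(bE x x0) lecR; apply: xmax.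
exact: mem_set.
Qed.

End MaximumOfMoebius.

(** * The exponent of a unicritical product against its degree *)

Section UnicriticalDegree.
Context {R : realType}.
Local Notation C := (R[i]).
Implicit Types (p : {poly C}) (z a : C).

Lemma poly_disk_eq0 p : (forall z, unit_disk z -> p.[z] = 0) -> p = 0.
Proof.
move=> p0; apply/eqP/negPn/negP => pn0.
pose rs := [seq (k.+2%:R : C)^-1 | k <- iota 0 (size p)].
have rsr : all (root p) rs.
  apply/allP => _ /mapP[k _ ->]; rewrite rootE p0 // /unit_disk /= ger0_norm ?invr_ge0 //.
  by rewrite invf_lt1 ?ltr0n // ltr1n.
have rsu : uniq rs.
  rewrite map_inj_uniq ?iota_uniq // => i j /invr_inj /eqP.
  by rewrite eqr_nat => /eqP [].
by have := max_poly_roots pn0 rsr rsu; rewrite size_map size_iota ltnn.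
Qed.

(** [unicritical] only gives equality of functions, so [m] has to be related to the list of zeros.
    After clearing denominators, (X - z0)^m divides N E^m, and E takes the nonzero value 1 - |z0|^2
    at z0; hence it divides [N]. *)
Lemma unicritical_degree (B : finite_blaschke R) z0 l m : unit_disk z0 -> `|l| = 1 ->
  (forall z, unit_disk z -> B z = l * ((z - z0) / (1 - z0^* * z)) ^+ m) ->
  (m <= blaschke_deg B)%N.
Proof.
move=> z1 l1 BE; have l0 := unimodular_neq0 l1; pose c := blaschke_const B.
have c0 : c != 0 by apply: unimodular_neq0; exact: blaschke_constP.
pose N : {poly C} := \prod_(a <- blaschke_zeros B) ('X - a%:P).
pose D : {poly C} := \prod_(a <- blaschke_zeros B) (1 - a^* *: 'X).
pose E : {poly C} := 1 - z0^* *: 'X.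
have ND : c *: (N * E ^+ m) = l *: (('X - z0%:P) ^+ m * D).
  apply/eqP; rewrite -subr_eq0; apply/eqP/poly_disk_eq0 => z zz.
  have Nz : N.[z] = \prod_(a <- blaschke_zeros B) (z - a).
    by rewrite horner_prod; apply: eq_bigr => a _; rewrite !hornerE.
  have Dz : D.[z] = \prod_(a <- blaschke_zeros B) (1 - a^* * z).
    by rewrite horner_prod; apply: eq_bigr => a _; rewrite !hornerE.
  have Ez : E.[z] = 1 - z0^* * z by rewrite !hornerE.
  have e0 : 1 - z0^* * z != 0.
    by rewrite sub1M_neq0 // norm_conjC ltW.
  have e0' : (1 - z0^* * z) ^+ m != 0 by rewrite expf_neq0.
  rewrite hornerD hornerN !hornerZ !hornerM !horner_exp hornerXsubC Nz Dz Ez.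
  have cross (x y c' e w b : C) : e != 0 -> b * x = c' * y -> b = l * (w / e) ->
      c' * (y * e) - l * (w * x) = 0.
    by move=> en bx be; rewrite mulrA -bx be; field.
  apply: cross e0' (blaschke_evalE B zz) _.
  by rewrite (BE z zz) expr_div_n.
have : ('X - z0%:P) ^+ m %| N * E ^+ m.
  have -> : N * E ^+ m = c^-1 *: (l *: (('X - z0%:P) ^+ m * D)).
    by rewrite -ND scalerA mulVf // scale1r.
  by rewrite !dvdpZr ?invr_eq0 // dvdp_mulr.
rewrite Gauss_dvdpl; last first.
  rewrite coprimep_expl // coprimep_expr // coprimep_sym coprimep_XsubC rootE !hornerE.
  by rewrite sub1M_neq0 // norm_conjC ltW.
move=> /dvdp_leq; rewrite monic_neq0 ?monic_prod_XsubC // => /(_ isT).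
by rewrite size_exp_XsubC size_prod_XsubC ltnS.
Qed.

End UnicriticalDegree.

(** * The numerical range in coordinates, and the conclusion *)

Lemma numerical_rangeE (R : realType) (Theta : finite_blaschke R) n :
  size (blaschke_zeros Theta) = n.+1 ->
  let s := blaschke_zeros Theta in
  let dot := row_form (n := n) (rat_form s) in
  let S := shift_mx (n := n) (\prod_(a <- s) ('X - a%:P)) in
  numerical_range (model_space Theta) (compressed_shift Theta) =
  [set dot (v *m S) v | v in [set v | dot v v = 1]].
Proof.
move=> sn s dot S; have s1 := @blaschke_in_disk R Theta.
have monicN : \prod_(a <- s) ('X - a%:P) \is monic by exact: monic_prod_XsubC.
have sizeN : size (\prod_(a <- s) ('X - a%:P)) = n.+2 by rewrite size_prod_XsubC sn.
have dotS v : dot (v *m S) v = rat_form s ('X * rVpoly v) (rVpoly v).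
  have phiN (r : {poly R[i]}) : (size r <= n.+1)%N ->
      rat_form s (\prod_(a <- s) ('X - a%:P)) r = 0.
    by rewrite -sn; exact: rat_form_prod_Xsub.
  have phiD p q r := rat_formDl p q r s1; have phiZ a p r := rat_formZl a p r s1.
  exact: (row_form_shift phiD phiZ monicN sizeN phiN).
apply/seteqP; split=> z /=.
  move=> [f [/model_spaceP[p]]]; rewrite sn => pn -> f1 <-.
  exists (poly_rV p); last first.
    by rewrite dotS poly_rV_K // (compressed_shift_inner sn pn).
  rewrite /dot /row_form poly_rV_K //.
  by have := sqrtCK (H2_inner (rat_seq s p) (rat_seq s p)); rewrite -/(H2_norm _) f1 expr1n.
move=> [v v1 <-]; exists (rat_seq s (rVpoly v)).
  split; first by apply/model_spaceP; exists (rVpoly v); rewrite ?sn ?size_poly.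
  have {}v1 : H2_inner (rat_seq s (rVpoly v)) (rat_seq s (rVpoly v)) = 1 := v1.
  by rewrite /H2_norm v1 sqrtC1.
by rewrite (compressed_shift_inner sn (size_poly _ _)) dotS.
Qed.

Local Open Scope complex_scope.

Theorem theorem1p5 (R : realType) (Theta B : finite_blaschke R)
    (hdeg : (blaschke_deg B < blaschke_deg Theta)%N) (hB : unicritical B) :
  exists2 m : R[i],
    is_max [set `|B z| | z in
              numerical_range (model_space Theta) (compressed_shift Theta)] m
    & 2^-1 <= m.
Proof.
have [z0 [l [m [z1 l1 m0 BE]]]] := hB.
have mB := unicritical_degree z1 l1 BE.
have [n sn] : exists n, size (blaschke_zeros Theta) = n.+1.
  by move: hdeg; rewrite /blaschke_deg; case: (size (blaschke_zeros Theta)) => // n; exists n.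
have mn : (m <= n)%N by rewrite (leq_trans mB) // -ltnS -sn.
set s := blaschke_zeros Theta in sn.
pose N : {poly R[i]} := \prod_(a <- s) ('X - a%:P).
pose dot := row_form (n := n) (rat_form s); pose S := shift_mx (n := n) N.
have s1 : in_disk s := @blaschke_in_disk R Theta.
have monicN : N \is monic by exact: monic_prod_XsubC.
have sizeN : size N = n.+2 by rewrite size_prod_XsubC sn.
have phiN (r : {poly R[i]}) : (size r <= n.+1)%N -> rat_form s N r = 0.
  by move=> rn; apply: rat_form_prod_Xsub => //; rewrite sn.
have phiD p q r := rat_formDl p q r s1.
have phiZ a p r := rat_formZl a p r s1.
have phiC p q := rat_formC p q s1.
have phi0 p : p != 0 -> 0 < rat_form s p p := rat_form_gt0 s1.
have phiX p q := rat_formX p q s1.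
have dot0 v : v != 0 -> 0 < dot v v by exact: row_form_gt0.
have dotD u v w : dot (u + v) w = dot u w + dot v w by exact: row_formDl.
have dotZ a u w : dot (a *: u) w = a * dot u w by exact: row_formZl.
have dotC u v : dot v u = (dot u v)^*%R by exact: row_formC.
have dotS v : v != 0 -> `|dot (v *m S) v| < dot v v.
  by move=> v0; apply: row_form_shift_lt.
have rangeP z : numerical_range (model_space Theta) (compressed_shift Theta) z <->
    exists2 v, v != 0 & z = dot (v *m S) v / dot v v.
  rewrite (numerical_rangeE sn); split=> [[v v1 <-]|[v v0 ->]].
    have {}v1 : dot v v = 1 := v1.
    exists v; last by rewrite v1 divr1.
    apply: contra_eq_neq v1 => ->; rewrite (dot0l dotZ) eq_sym; exact: oner_neq0.
  have vv := dot0 _ v0; pose c := (sqrtC (dot v v))^-1.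
  have cc : c * (c^*)%R = (dot v v)^-1.
    rewrite -normCK ger0_norm ?invr_ge0 ?sqrtC_ge0 ?(ltW vv) // exprVn.
    by rewrite sqrtCK.
  have c1 : dot (c *: v) (c *: v) = 1.
    by rewrite dotZ (dotZr dotZ dotC) mulrA cc mulVf ?lt0r_neq0.
  exists (c *: v); first exact: c1.
  by rewrite -[LHS]/(dot (c *: v *m S) (c *: v)) -scalemxAl dotZ (dotZr dotZ dotC) mulrA cc mulrC.
have disk z : (exists2 v, v != 0 & z = dot (v *m S) v / dot v v) -> unit_disk z.
  move=> [v v0 ->]; have vv := dot0 _ v0.
  by rewrite /unit_disk /= normrM normfV (ger0_norm (ltW vv)) ltr_pdivrMr // mul1r dotS.
have normB z : unit_disk z -> `|B z| = (`|z - z0| / `|1 - (z0^*)%R * z|) ^+ m.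
  by move=> zz; rewrite BE // normrM l1 mul1r normrX normrM normfV.
have [v v0 vmax] := form_moebius_max dotD dotZ dotC dot0 z1 dotS.
set z := dot (v *m S) v / dot v v in vmax.
have zW : exists2 v, v != 0 & z = dot (v *m S) v / dot v v by exists v.
set mu := `|z - z0| / `|1 - (z0^*)%R * z| in vmax.
have mu0 : 0 <= mu by rewrite divr_ge0.
exists (`|B z|).
  split; first by exists z => //; apply/rangeP.
  move=> _ [w /rangeP wW <-]; rewrite (normB _ (disk _ wW)) (normB _ (disk _ zW)).
  have [u u0 wE] := wW; rewrite ler_pXn2r ?nnegrE ?divr_ge0 // wE.
  exact: vmax.
rewrite (normB _ (disk _ zW)) -/mu.
have mum : 0 <= mu ^+ m by rewrite exprn_ge0.
rewrite real_leNgt ?ger0_real ?invr_ge0 //; apply/negP => mu_lt.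
(* The midpoint leaves room on both sides: its m-th root [rho] strictly exceeds the maximum [mu], as
   the bound on the numerical range demands, and still rho^m < 1/2. *)
pose c := (mu ^+ m + 2^-1) / 2.
have c_lt : c < 2^-1 by rewrite /c ltr_pdivrMr // mulr_natr mulr2n ltrD2r.
have mu_c : mu ^+ m < c by rewrite /c ltr_pdivlMr // mulr_natr mulr2n ltrD2l.
have c0 : 0 < c by exact: le_lt_trans mu_c.
pose rho := m.-root c.
have rhom : rho ^+ m = c by rewrite rootCK.
have rho0 : 0 < rho by rewrite rootC_gt0.
have rho1 : rho < 1.
  rewrite rootC_lt1 ?(ltW c0) //; apply: lt_trans c_lt _.
  by rewrite invf_lt1 // ltr1n.
have mu_rho : mu < rho by rewrite -(ltr_pXn2r m0) ?nnegrE ?(ltW rho0) // rhom.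
have := @row_form_unicritical_bound _ n _ N phiD phiZ phiC phi0 phiX monicN sizeN
  z0 rho m z1 rho0 rho1.
rewrite m0 mn rhom => /(_ isT) bound.
suff : 2^-1 <= c by move=> /le_lt_trans/(_ c_lt); rewrite ltxx.
apply: bound => w w0 /=; have := vmax w w0.
have wd : unit_disk (dot (w *m S) w / dot w w) by apply: disk; exists w.
have e0 : 0 < `|1 - (z0^*)%R * (dot (w *m S) w / dot w w)|.
  by rewrite normr_gt0 sub1M_neq0 // norm_conjC ltW.
by move=> /le_lt_trans/(_ mu_rho); rewrite ltr_pdivrMr.
Qed.
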